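(* Fix $n\in\{0,\dots,N-1\}$. Assume that there are constants $\lambda_1,\lambda_2>0$ such that for all $x,y\in\mathbb{R}^d$ and every grid time $t\in\{t_0,\dots,t_{N-1}\}$ $$|\rho(x,t;y,t+\Delta t)|\le \frac{1}{\lambda_1}\exp(-\lambda_1\|x-y\|^2),\qquad |\nabla_x\rho(x,t;y,t+\Delta t)|\le \frac{1}{\lambda_2}\exp(-\lambda_2\|x-y\|^2),$$ and that $|\widehat V_i(t_{n+1},x)|\le L(\|x\|+1)$ for all $x\in\mathbb{R}^d$, all $i=1,\dots,D$ and some $L>0$. Then for any fixed bounded set $Q\subset\mathbb{R}^d$ there exist positive constants $C_0$ (used as the truncation constant in the definition of $\widehat g_j(t_n,\cdot)$), $C_1$, $C_2$ and $\sigma$, depending only on $d,L,Q,\lambda_1,\lambda_2$, such that for any $\delta>0$ and every $i\in\{1,\dots,D\}$ $$\mathbb{P}\Big(\sup_{x\in Q}|\widehat V_i(t_n,x)-\widetilde V_i(t_n,x)|\ge\delta\Big)\le 2D\binom{M}{k}\exp\Big(-\frac{k m_Y\delta^2}{18\sigma^2}\Big)+D\cdot B(\delta),$$ where $$B(\delta)=\begin{cases} C_1\dfrac{|Q|}{\delta^{d}}\exp\left(-\dfrac{M\left(\frac{M-k}{M}-\sup_{x\in Q}p^c_{\delta/(4C_2)}(x)\right)_+^2}{2}\right) & \text{if }\delta/C_2\le 1,\\[3mm] C_1\dfrac{|Q|}{\delta^{d/2}}\exp\left(-\dfrac{M\left(\frac{M-k}{M}-\sup_{x\in Q}p^c_{\sqrt{\delta/(4C_2)}}(x)\right)_+^2}{2}\right)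 & \text{if }\delta/C_2>1.\end{cases}$$ Here $p^c_r(x)=\mathbb{P}(X_{t_n}\notin B(x,r))$, $B(x,r)$ is the Euclidean ball of radius $r$ centered at $x$, and $|Q|$ is the volume of $Q$.
   Context: Setting. Let $d,D,M,N,m_Y,k$ be positive integers with $k\le M$, $T>0$, $\Delta t=T/N$, $t_n=n\Delta t$. $(X_{t_n})_{n=0}^N$ is a (time-discretized) Markov process in $\mathbb{R}^d$ whose starting point is drawn from a sub-Gaussian distribution $\mu_0$ and whose one-step transition kernel from $t_n$ to $t_{n+1}$ has a density $y\mapsto\rho(x,t_n;y,t_n+\Delta t)$. There are $D$ modes with payoff functions $f_j(t,x)$ and switching costs $c_{ij}(t,x)$ satisfying $c_{ii}=0$, $c_{ij}>0$ for $i\ne j$, and $c_{ij}+c_{jl}\ge c_{il}$ for pairwise distinct $i,j,l$. $\|\cdot\|$ is the Euclidean norm and $(a)_+=\max\{a,0\}$. Data. $\mathcal{X}=\{X^s_{t_0},\dots,X^s_{t_N};\ s=1,\dots,M\}$ consists of $M$ independent copies of the trajectory. For each $n<N$ and $s$, $\widetilde X^{s,\hat s}_{t_{n+1}}$, $\hat s=1,\dots,m_Y$, are simulated one-step transitions started from $X^s_{t_n}$: conditional on $\mathcal{X}$, all of these are mutually independent across $(n,s,\hat s)$, and $\widetilde X^{s,\hat s}_{t_{n+1}}$ has density $\rho(X^s_{t_n},t_n;\cdot,t_{n+1})$. $\mathcal{N}_{t_n}(x)$ is the set of indices $s$ of the $k$ points among $X^1_{t_n},\dots,X^M_{t_n}$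 nearest to $x$. Estimators (backward recursion). Start from $\widehat V_j(t_N,x)=0$. For $n=N-1,\dots,0$, given $\widehat V_j(t_{n+1},\cdot)$, $j=1,\dots,D$, define $$g_j(t_n,x)=\int_{\mathbb{R}^d}\widehat V_j(t_{n+1},y)\rho(x,t_n;y,t_n+\Delta t)\,dy,\qquad \widetilde g_j(t_n,x)=\frac{1}{k m_Y}\sum_{s\in\mathcal{N}_{t_n}(x)}\sum_{\hat s=1}^{m_Y}\widehat V_j(t_{n+1},\widetilde X^{s,\hat s}_{t_{n+1}}),$$ the truncation $$\widehat g_j(t_n,x)=\mathrm{sign}(\widetilde g_j(t_n,x))\min\{|\widetilde g_j(t_n,x)|,\,2C_0(\|x\|+1)\}$$ with a given constant $C_0$ (which may depend on $n$), and $$\widetilde V_i(t_n,x)=\max_{j=1,\dots,D}[\Delta t f_j(t_n,x)-c_{ij}(t_n,x)+g_j(t_n,x)],\qquad \widehat V_i(t_n,x)=\max_{j=1,\dots,D}[\Delta t f_j(t_n,x)-c_{ij}(t_n,x)+\widehat g_j(t_n,x)].$$ Note that $g_j$ and $\widetilde V_i$ are random, through $\widehat V_j(t_{n+1},\cdot)$.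
   Formalization: The bounded set Q is assumed to be Borel with positive volume |Q| > 0; for nonempty Q of volume zero, B(δ) vanishes and the claim is false (e.g. Q = {0}, X starting at 10, M = k = 1, m_Y → ∞). *)

(* Defs.v *)
From HB Require Import structures.
From mathcomp Require Import all_boot all_order all_algebra.
From mathcomp Require Import all_classical all_reals all_analysis.

Set Implicit Arguments.
Unset Strict Implicit.
Unset Printing Implicit Defensive.

Import Order.TTheory GRing.Theory Num.Theory.
Import numFieldNormedType.Exports.

Local Open Scope classical_set_scope.
Local Open Scope ring_scope.

(* 'rV[R]_d carries the product (= Borel) sigma-algebra, generated by the
   coordinates. *)
Section measurable_rV.
Context {R : realType} {d : nat}.

Let coord : 'I_d -> 'rV[R]_d -> R := fun i x => x 0 i.

Let rV_set0 : g_sigma_preimage coord set0.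
Proof. exact: sigma_algebra0. Qed.

Let rV_setC A : g_sigma_preimage coord A -> g_sigma_preimage coord (~` A).
Proof. exact: sigma_algebraC. Qed.

Let rV_bigcup (F : (set 'rV[R]_d)^nat) :
  (forall i, g_sigma_preimage coord (F i)) ->
  g_sigma_preimage coord (\bigcup_i (F i)).
Proof. exact: sigma_algebra_bigcup. Qed.

HB.instance Definition _ := @isMeasurable.Build
  (measure_tuple_display default_measure_display)
  'rV[R]_d (g_sigma_preimage coord) rV_set0 rV_setC rV_bigcup.

Lemma measurable_coord (i : 'I_d) :
  measurable_fun [set: 'rV[R]_d] (fun x : 'rV[R]_d => x 0 i).
Proof.
move=> _ Y mY; rewrite setTI; apply: sub_sigma_algebra => /=.
rewrite -bigcup_seq/=; exists i => /=; first by rewrite mem_index_enum.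
by exists Y => //; rewrite setTI.
Qed.

Lemma measurable_fun_rV d' (T : measurableType d') (h : T -> 'rV[R]_d) :
  (forall i, measurable_fun [set: T] (fun t => h t 0 i)) ->
  measurable_fun [set: T] h.
Proof.
move=> mh.
have sub : g_sigma_preimage (fun i => coord i \o h) `<=` measurable.
  apply: smallest_sub; first exact: sigma_algebra_measurable.
  rewrite -bigcup_seq; apply: bigcup_sub => i _ A [B mB <-].
  exact: (mh i).
rewrite g_sigma_preimage_comp in sub => _ A mA.
by apply: sub; exists A.
Qed.

End measurable_rV.

Section lebesgue_rV.
Context {R : realType}.

Definition rV_cons n (p : measurableTypeR R * 'rV[R]_n) : 'rV[R]_n.+1 :=
  row_mx (p.1)%:M p.2.

Definition rV_uncons n (x : 'rV[R]_n.+1) :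
    measurableTypeR R * 'rV[R]_n :=
  (x 0 0, rsubmx (x : 'rV[R]_(1 + n))).

Lemma rV_consK n : cancel (@rV_cons n) (@rV_uncons n).
Proof.
case=> a v; rewrite /rV_cons /rV_uncons row_mxKr; congr (_, _).
rewrite -[LHS]/(row_mx a%:M v 0 (0 : 'I_(1 + n))) /=.
rewrite (_ : 0 = lshift n (0 : 'I_1)); last exact/val_inj.
by rewrite row_mxEl mxE eqxx mulr1n.
Qed.

Lemma rV_cons_measurable n : 
  measurable_fun [set: measurableTypeR R * 'rV[R]_n] (@rV_cons n).
Proof.
apply: measurable_fun_rV => i; rewrite /rV_cons.
under eq_fun do rewrite mxE; case: (fintype.split (i : 'I_(1 + n))) => j.
- under eq_fun do rewrite (ord1 j) mxE eqxx mulr1n.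
  exact: measurable_fst.
- exact: (measurableT_comp (measurable_coord j) measurable_snd).
Qed.

Lemma rV_uncons_measurable n : measurable_fun [set: 'rV[R]_n.+1] (@rV_uncons n).
Proof.
apply: measurable_fun_pair; first exact: measurable_coord.
apply: measurable_fun_rV => i; under eq_fun do rewrite mxE.
exact: measurable_coord.
Qed.

Section step.
Variables (n : nat) (m : {sigma_finite_measure set 'rV[R]_n -> \bar R}).

Definition lebesgue_rV_step : set 'rV[R]_n.+1 -> \bar R :=
  pushforward (@lebesgue_measure R \x m)%E (@rV_cons n).

Let step_measure : {measure set 'rV[R]_n.+1 -> \bar R} :=
  measure_function_pushforward__canonical__measure_function_Measure
    (@lebesgue_measure R \x m)%E (@rV_cons_measurable n).

Let step0 : lebesgue_rV_step set0 = 0%E.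
Proof. exact: (measure0 step_measure). Qed.

Let step_ge0 A : (0 <= lebesgue_rV_step A)%E.
Proof. exact: (measure_ge0 step_measure A). Qed.

Let step_sigma_additive : semi_sigma_additive lebesgue_rV_step.
Proof. exact: (@measure_semi_sigma_additive _ _ _ step_measure). Qed.

HB.instance Definition _ := @isMeasure.Build _ _ _
  lebesgue_rV_step step0 step_ge0 step_sigma_additive.

Let step_sigma_finite : sigma_finite [set: 'rV[R]_n.+1] lebesgue_rV_step.
Proof.
have /sigma_finiteP[F [TF ndF Foo]] := sigma_finiteT (@lebesgue_measure R).
have /sigma_finiteP[G [TG ndG Goo]] := sigma_finiteT m.
exists (fun k => @rV_uncons n @^-1` (F k `*` G k)).
  rewrite -preimage_bigcup (_ : \bigcup_i _ = setT) ?preimage_setT//.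
  rewrite -subTset => -[x y] _.
  have [k _ Fkx] : (\bigcup_i F i) x by rewrite -TF.
  have [l _ Gly] : (\bigcup_i G i) y by rewrite -TG.
  exists (maxn k l) => //; split => /=.
  - by move: x Fkx; exact/subsetPset/ndF/leq_maxl.
  - by move: y Gly; exact/subsetPset/ndG/leq_maxr.
move=> k; have [mF Fk] := Foo k; have [mG Gk] := Goo k; split.
  rewrite -[X in measurable X]setTI; apply: rV_uncons_measurable => //.
  exact: measurableX.
rewrite /lebesgue_rV_step /pushforward -comp_preimage.
rewrite (_ : _ \o _ = id) ?preimage_id; last first.
  by apply/funext => p; exact: rV_consK.
by rewrite product_measure1E// lte_mul_pinfty// ge0_fin_numE.
Qed.

HB.instance Definition _ := @Measure_isSigmaFinite.Build _ _ _
  lebesgue_rV_step step_sigma_finite.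

End step.

(* Lebesgue measure on R^n: the unit mass on R^0, and the product of the
   one-dimensional Lebesgue measure with Lebesgue measure on R^n on R^(n+1). *)
Fixpoint lebesgue_rV n : {sigma_finite_measure set 'rV[R]_n -> \bar R} :=
  match n with
  | 0 => (\d_(0 : 'rV[R]_0) : {sigma_finite_measure set _ -> \bar R})
  | n'.+1 => (lebesgue_rV_step (lebesgue_rV n')
               : {sigma_finite_measure set _ -> \bar R})
  end.

End lebesgue_rV.
Arguments lebesgue_rV {R} n.

Section euclidean.
Context {R : realType} {d : nat}.
Implicit Types x : 'rV[R]_d.

(* The library's norm on 'rV[R]_d is the sup norm. *)
Definition enorm x : R := Num.sqrt (\sum_i x 0 i ^+ 2).

Definition eball x (r : R) : set 'rV[R]_d := [set y | enorm (y - x) < r].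

Definition grad (h : 'rV[R]_d -> R) x : 'rV[R]_d :=
  \row_i 'D_(delta_mx 0 i) h x.

(* Sub-Gaussian tail of the Euclidean norm; mu need not be centred. *)
Definition sub_gaussian (mu : probability 'rV[R]_d R) :=
  exists2 K : R, 0 < K & forall r : R, 0 <= r ->
    (mu [set x | (r <= enorm x)%R] <= (2 * expR (- (r ^+ 2 / K ^+ 2)))%:E)%E.

End euclidean.

Definition grid {R : realType} (T : R) (N m : nat) : R := m%:R * (T / N%:R).

(* The transition density y |-> rho(x, s; y, t) is written [rho x s y t]. *)
Section markov.
Context {R : realType} {d : nat}.
Variables (T : R) (N : nat) (rho : 'rV[R]_d -> R -> 'rV[R]_d -> R -> R).

Definition transition_density :=
  forall m, (m < N)%N ->
  [/\ measurable_fun [set: 'rV[R]_d * 'rV[R]_d]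
        (fun p => rho p.1 (grid T N m) p.2 (grid T N m.+1)),
      forall x y, 0 <= rho x (grid T N m) y (grid T N m.+1) &
      forall x, (\int[lebesgue_rV d]_y
                  (rho x (grid T N m) y (grid T N m.+1))%:E = 1)%E].

Definition transition (m : nat) (x : 'rV[R]_d) (B : set 'rV[R]_d) : R :=
  (\int[lebesgue_rV d]_(y in B) rho x (grid T N m) y (grid T N m.+1))%R.

Context {d0 : measure_display} {Omega : measurableType d0}.
Variable P : probability Omega R.

Definition history (m : nat) (Y : nat -> Omega -> 'rV[R]_d) (w : Omega) :
  m.+1.-tuple 'rV[R]_d := [tuple Y j w | j < m.+1].

(* The conditional law of Y_{m+1} given Y_0, ..., Y_m has density
   rho(Y_m, t_m; ., t_{m+1}). *)
Definition markov_process (mu0 : probability 'rV[R]_d R)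
    (Y : nat -> {RV P >-> 'rV[R]_d}) :=
  (forall A, measurable A -> P (Y 0 @^-1` A) = mu0 A) /\
  (forall m, (m < N)%N -> forall E B, measurable E -> measurable B ->
     P (history m Y @^-1` E `&` Y m.+1 @^-1` B) =
     (\int[P]_(w in history m Y @^-1` E) (transition m (Y m w) B)%:E)%E).

Context {M mY : nat}.

Definition independent_copies (Y : nat -> {RV P >-> 'rV[R]_d})
    (Ys : 'I_M -> nat -> {RV P >-> 'rV[R]_d}) :=
  (forall s E, measurable E -> P (history N (Ys s) @^-1` E) = P (history N Y @^-1` E))
  /\
  (forall E : 'I_M -> set (N.+1.-tuple 'rV[R]_d),
     (forall s, measurable (E s)) ->
     P [set w | forall s, E s (history N (Ys s) w)] =
     (\prod_(s < M) P (history N (Ys s) @^-1` E s))%E).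

Definition sample (Ys : 'I_M -> nat -> {RV P >-> 'rV[R]_d}) (w : Omega) :
  M.-tuple (N.+1.-tuple 'rV[R]_d) := [tuple history N (Ys s) w | s < M].

(* Conditionally on the sample, the Yt m s h (m < N) are mutually independent
   and Yt m s h, which lives at time t_{m+1}, has density
   rho(Ys s m, t_m; ., t_{m+1}). *)
Definition one_step_simulations (Ys : 'I_M -> nat -> {RV P >-> 'rV[R]_d})
    (Yt : nat -> 'I_M -> 'I_mY -> {RV P >-> 'rV[R]_d}) :=
  forall (E : set (M.-tuple (N.+1.-tuple 'rV[R]_d)))
         (B : 'I_N -> 'I_M -> 'I_mY -> set 'rV[R]_d),
    measurable E -> (forall m s h, measurable (B m s h)) ->
    P (sample Ys @^-1` E `&`
       [set w | forall (m : 'I_N) s h, B m s h (Yt m s h w)]) =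
    (\int[P]_(w in sample Ys @^-1` E)
       (\prod_(m < N) \prod_(s < M) \prod_(h < mY)
          transition m (Ys s m w) (B m s h))%:E)%E.

End markov.

Section switching.
Context {R : realType} {d D : nat}.

Definition switching_costs (T : R) (c : 'I_D -> 'I_D -> R -> 'rV[R]_d -> R) :=
  forall t x, 0 <= t <= T ->
  [/\ forall i, c i i t x = 0,
      forall i j, i != j -> 0 < c i j t x &
      forall i j l, i != j -> j != l -> i != l ->
        c i l t x <= c i j t x + c j l t x].

Definition measurable_data (T : R) (f : 'I_D -> R -> 'rV[R]_d -> R)
    (c : 'I_D -> 'I_D -> R -> 'rV[R]_d -> R) :=
  forall t, 0 <= t <= T ->
  (forall j, measurable_fun [set: 'rV[R]_d] (f j t)) /\
  (forall i j, measurable_fun [set: 'rV[R]_d] (c i j t)).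

End switching.

Section estimators.
Context {R : realType} {d D M mY : nat}.
Variables (T : R) (N k : nat).
Variables (f : 'I_D -> R -> 'rV[R]_d -> R).
Variables (c : 'I_D -> 'I_D -> R -> 'rV[R]_d -> R).
(* [C m] is the truncation constant used at time t_m. *)
Variable C : nat -> R.
(* Realizations of the data: [xs s m] is X^s at t_m, and [xt m s h] is the h-th
   one-step transition simulated from [xs s m]. *)
Variables (xs : 'I_M -> nat -> 'rV[R]_d).
Variables (xt : nat -> 'I_M -> 'I_mY -> 'rV[R]_d).

(* The k indices whose points are nearest to x, ties being broken in favour of
   the smaller index. *)
Definition closer m (x : 'rV[R]_d) (r s : 'I_M) : bool :=
  (enorm (xs r m - x) < enorm (xs s m - x)) ||
  ((enorm (xs r m - x) == enorm (xs s m - x)) && (r < s)%N).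

Definition knn m (x : 'rV[R]_d) : {set 'I_M} :=
  [set s : 'I_M | (#|[pred r | closer m x r s]| < k)%N]%SET.

(* The maximum is seeded with its i-th term, hence is over exactly 'I_D. *)
Definition best_switch m (G : 'I_D -> 'rV[R]_d -> R) (i : 'I_D)
    (x : 'rV[R]_d) : R :=
  let v j := T / N%:R * f j (grid T N m) x - c i j (grid T N m) x + G j x in
  \big[Num.max/v i]_(j < D) v j.

(* [W] stands for the estimates of the value functions at time t_{m+1}. *)
Definition g_tilde_of m (W : 'I_D -> 'rV[R]_d -> R) (j : 'I_D)
    (x : 'rV[R]_d) : R :=
  (k%:R * mY%:R)^-1 * \sum_(s in knn m x) \sum_(h < mY) W j (xt m s h).

Definition g_hat_of m (W : 'I_D -> 'rV[R]_d -> R) (j : 'I_D)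
    (x : 'rV[R]_d) : R :=
  Num.sg (g_tilde_of m W j x) *
  Num.min `|g_tilde_of m W j x| (2 * C m * (enorm x + 1)).

(* [V_hat_before r] is the estimate r steps before the horizon. *)
Fixpoint V_hat_before (r : nat) : 'I_D -> 'rV[R]_d -> R :=
  if r is r'.+1 then
    best_switch (N - r) (g_hat_of (N - r) (V_hat_before r'))
  else fun _ _ => 0.

Definition V_hat m : 'I_D -> 'rV[R]_d -> R := V_hat_before (N - m).

Definition g_exact (rho : 'rV[R]_d -> R -> 'rV[R]_d -> R -> R) m (j : 'I_D)
    (x : 'rV[R]_d) : R :=
  (\int[lebesgue_rV d]_y
     (V_hat m.+1 j y * rho x (grid T N m) y (grid T N m.+1)))%R.

Definition V_tilde rho m : 'I_D -> 'rV[R]_d -> R :=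
  best_switch m (g_exact rho m).

Lemma V_hatN : V_hat N = fun _ _ => 0.
Proof. by rewrite /V_hat subnn. Qed.

Lemma V_hatE m : (m < N)%N ->
  V_hat m = best_switch m (g_hat_of m (V_hat m.+1)).
Proof.
by move=> mN; rewrite /V_hat -(subnSK mN)/= subnSK// subKn// ltnW.
Qed.

End estimators.

Section bound.
Context {R : realType} {d : nat} {d0 : measure_display}.
Context {Omega : measurableType d0}.
Variables (P : probability Omega R) (Y : Omega -> 'rV[R]_d).

Definition pc (r : R) (x : 'rV[R]_d) : R :=
  fine (P [set w | ~ eball x r (Y w)]).

Definition sup_pc (Q : set 'rV[R]_d) (r : R) : R := sup [set pc r x | x in Q].

Definition volume (Q : set 'rV[R]_d) : R := fine (lebesgue_rV d Q).

Definition B_term (Q : set 'rV[R]_d) (M k : nat) (C1 C2 delta : R) : R :=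
  let tail r :=
    expR (- (M%:R * Num.max ((M%:R - k%:R) / M%:R - sup_pc Q r) 0 ^+ 2 / 2)) in
  if delta / C2 <= 1 then
    C1 * (volume Q / delta ^+ d) * tail (delta / (4 * C2))
  else
    C1 * (volume Q / delta `^ (d%:R / 2)) * tail (Num.sqrt (delta / (4 * C2))).

End bound.

(* Main.v *)
From HB Require Import structures.
Require Import Defs.
From mathcomp Require Import all_boot all_order all_algebra.
From mathcomp Require Import all_classical all_reals all_analysis measurable_realfun.
From mathcomp Require Import lra ring.

Set Implicit Arguments.
Unset Strict Implicit.
Unset Printing Implicit Defensive.

Import Order.TTheory GRing.Theory Num.Theory.
Import numFieldNormedType.Exports.

Local Open Scope classical_set_scope.
Local Open Scope ring_scope.

(** Truncation is a projection, so the error of the estimator is bounded by that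
    of the untruncated nearest-neighbour average, which splits into a sampling
    part and a displacement part. The regression function is Lipschitz on bounded
    sets (Gaussian bound on the gradient of the density), so the displacement part
    is small as soon as the k nearest neighbours of every point of Q are close;
    covering Q by balls of radius delta / (4 C2), this follows from a Hoeffding
    bound for the number of data points in each ball. For the sampling part, given
    the sample and the later simulations, the one-step simulations are independent
    and, near Q, their values have exponential moments; integrating them out one
    at a time gives a Chernoff bound for each set of k indices, hence the union
    over 'C(M, k) sets. For large delta the truncation makes the event null. *)

(** The nearest-neighbour set and the estimates at [t_(n+1)] both depend on the sample, so no
    concentration bound applies to the average over [knn] itself. Fixing an arbitrary set of k
    indices removes this dependence and the supremum over x together; that is where the binomial
    coefficient comes from. Independence survives because the backward recursion at [t_(n+1)] reads
    only points and simulations of times from [t_(n+1)] on: the estimate stays measurable when one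
    simulation started at [t_n] is ignored. The values grow linearly, so an inequality for bounded
    variables is out of reach. The Gaussian bound on the density gives instead an exponential moment
    [exp(v * th^2)], but only for [|th| <= 1]; hence the Chernoff bound covers only delta below a
    constant, and larger delta need the separate argument by truncation. Two obstacles shape the
    rest. The growth bound on the estimates holds only almost surely, so a clipped surrogate that
    obeys it everywhere is used inside the integrals. The supremum over Q need not be measurable, so
    the event is covered by measurable ones and bounded in outer measure. *)

(** * Elementary inequalities for the exponential *)

Section exponential_bounds.
Context {R : realType}.
Implicit Types x : R.

(** The inequality e^x - 1 <= x e^x bounds the remainder e^x - 1 - x by x (e^x - 1), which is at
    most x^2 e^|x|. It is needed for every real x, since the deviations are unbounded. *)
Lemma expR_le_sqr_exp x : expR x <= 1 + x + x ^+ 2 * expR `|x|.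
Proof.
have h1 : expR x - 1 <= x * expR x.
  have := expR_ge1Dx (- x); rewrite expRN => h.
  have e0 := expR_gt0 x.
  rewrite -subr_ge0 in h; have := mulr_ge0 (ltW e0) h.
  rewrite mulrBr divff ?gt_eqF// => {}h; lra.
have h2 := expR_ge1Dx x.
have h3 : expR x - 1 - x <= x * (expR x - 1) by lra.
have h4 : x * (expR x - 1) <= x ^+ 2 * expR `|x|.
  case: (lerP 0 x) => x0.
    by rewrite expr2 -mulrA ler_wpM2l// ger0_norm//.
  have e1 : 1 <= expR (- x) by rewrite -expR0 ler_expR; lra.
  have : x * (expR x - 1) <= x ^+ 2 by rewrite expr2; nra.
  by move=> /le_trans; apply; rewrite ler_peMr ?sqr_ge0// -expR0 ler_expR normr_ge0.
have := le_trans h3 h4; rewrite -addrA -lerBlDl; lra.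
Qed.

(* (1 - t) ^ 8 * (1 + x + x ^ 2) - 1 with x = 8 t is t ^ 2 times this. *)
Let degree8_ge0 (t : R) : 0 <= t -> t <= 8^-1 ->
  0 <= 28 - 344 * t + 1414 * t ^+ 2 - 3080 * t ^+ 3 +
       (t ^+ 4 * (4060 - 3368 * t) + t ^+ 6 * (1729 - 504 * t) + 64 * t ^+ 8).
Proof.
move=> t0 t1.
have -> : 28 - 344 * t + 1414 * t ^+ 2 - 3080 * t ^+ 3 =
  (1 - 8 * t) * (28 - 120 * t) + t ^+ 2 * (454 - 3080 * t) by ring.
have f1 : 0 <= 1 - 8 * t by lra.
have f2 : 0 <= 28 - 120 * t by lra.
have f3 : 0 <= 454 - 3080 * t by lra.
have f4 : 0 <= 4060 - 3368 * t by lra.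
have f6 : 0 <= 1729 - 504 * t by lra.
exact (addr_ge0 (addr_ge0 (mulr_ge0 f1 f2) (mulr_ge0 (sqr_ge0 t) f3))
  (addr_ge0 (addr_ge0 (mulr_ge0 (exprn_ge0 4 t0) f4)
    (mulr_ge0 (exprn_ge0 6 t0) f6)) (mulr_ge0 (ler0n R 64) (exprn_ge0 8 t0)))).
Qed.

(** For x > 0, raising e^(-x/8) >= 1 - x/8 to the eighth power replaces the exponential by a
    polynomial: it suffices that (1 - t)^8 (1 + x + x^2) >= 1 where x = 8 t. *)
Lemma expR_le_quadratic x : `|x| <= 1 -> expR x <= 1 + x + x ^+ 2.
Proof.
move=> /ler_normlP[x1 x2]; have [x0|x0] := lerP x 0.
  have h1 := expR_ge1Dx (- x); rewrite expRN in h1.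
  have h2 := expR_ge1Dx x; have h3 := expR_gt0 x.
  have h4 : (1 - x) * expR x <= 1.
    by rewrite -ler_pdivlMr ?expR_gt0// mul1r.
  have h5 : x * (expR x - 1) <= x * x by apply: ler_wnM2l => //; lra.
  by rewrite expr2; lra.
set t : R := x / 8.
have tx : x = 8 * t by rewrite /t; lra.
have ep : 0 < expR t := expR_gt0 t.
have et : expR t * (1 - t) <= 1.
  by rewrite mulrC -ler_pdivlMr ?expR_gt0// mul1r -expRN expR_ge1Dx.
have t0 : 0 <= t by rewrite /t; lra.
have t1 : t <= 8^-1 by rewrite /t; lra.
have -> : expR x = expR t ^+ 8 by rewrite -expRM_natl tx mulrC.
have h8 : (expR t * (1 - t)) ^+ 8 <= 1.
  by apply: exprn_ile1 => //; apply: mulr_ge0; lra.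
have p8 : 1 <= (1 - t) ^+ 8 * (1 + x + x ^+ 2).
  rewrite tx.
  have -> : (1 - t) ^+ 8 * (1 + 8 * t + (8 * t) ^+ 2) =
     1 + t ^+ 2 * (28 - 344 * t + 1414 * t ^+ 2 - 3080 * t ^+ 3 +
       (t ^+ 4 * (4060 - 3368 * t) + t ^+ 6 * (1729 - 504 * t) + 64 * t ^+ 8)).
    by ring.
  by rewrite lerDl; apply: mulr_ge0; [exact: sqr_ge0|exact: degree8_ge0].
rewrite exprMn in h8.
have e8 : 0 < expR t ^+ 8 by rewrite exprn_gt0.
have q0 : 0 <= 1 + x + x ^+ 2 by rewrite addr_ge0 ?sqr_ge0// addr_ge0// ltW.
rewrite -[leLHS]mulr1; apply: le_trans (ler_wpM2l (ltW e8) p8) _.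
by rewrite mulrA ler_piMl.
Qed.

End exponential_bounds.

(** * The Euclidean norm on row vectors *)

Section euclidean_norm.
Context {R : realType} {d : nat}.
Implicit Types x y z : 'rV[R]_d.

(** The sum of the squares (B a_i - S b_i)^2 equals B (A B - S^2); dividing by B requires B > 0, and
    B = 0 forces b = 0. *)
Lemma cauchy_schwarz (I : finType) (a b : I -> R) :
  `|\sum_i a i * b i| <=
    Num.sqrt (\sum_i a i ^+ 2) * Num.sqrt (\sum_i b i ^+ 2).
Proof.
set A := \sum_i a i ^+ 2; set B := \sum_i b i ^+ 2; set S := \sum_i _ * _.
have A0 : 0 <= A by rewrite sumr_ge0// => i _; exact: sqr_ge0.
have B0 : 0 <= B by rewrite sumr_ge0// => i _; exact: sqr_ge0.
rewrite -sqrtrM// -sqrtr_sqr ler_sqrt ?mulr_ge0//.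
have : 0 <= \sum_i (B * a i - S * b i) ^+ 2.
  by rewrite sumr_ge0// => i _; exact: sqr_ge0.
have -> : \sum_i (B * a i - S * b i) ^+ 2 = B * (A * B - S ^+ 2).
  transitivity (\sum_i (B ^+ 2 * a i ^+ 2 - 2 * B * S * (a i * b i)
      + S ^+ 2 * b i ^+ 2)); first by apply: eq_bigr => i _; ring.
  by rewrite big_split sumrB/= -!mulr_sumr -/A -/B -/S; ring.
have [Bp|Bn] := ltrP 0 B; first by rewrite pmulr_rge0// subr_ge0.
have B00 : B = 0 by apply/eqP; rewrite eq_le Bn.
have b0 i : b i = 0.
  move/eqP: B00; rewrite psumr_eq0; last by move=> j _; exact: sqr_ge0.
  by move=> /allP/(_ i); rewrite mem_index_enum sqrf_eq0 => /(_ isT)/eqP.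
have -> : S = 0 by rewrite /S big1// => i _; rewrite b0 mulr0.
by rewrite expr0n => _; apply: mulr_ge0.
Qed.

Lemma enorm_ge0 x : 0 <= enorm x. Proof. exact: sqrtr_ge0. Qed.

Lemma sqr_enorm x : enorm x ^+ 2 = \sum_i x 0 i ^+ 2.
Proof. by rewrite sqr_sqrtr// sumr_ge0// => i _; exact: sqr_ge0. Qed.

Lemma enormN x : enorm (- x) = enorm x.
Proof. by congr Num.sqrt; apply: eq_bigr => i _; rewrite mxE sqrrN. Qed.

Lemma enorm_distC x y : enorm (x - y) = enorm (y - x).
Proof. by rewrite -enormN opprB. Qed.

Lemma enormZ (a : R) x : enorm (a *: x) = `|a| * enorm x.
Proof.
rewrite -sqrtr_sqr -sqrtrM ?sqr_ge0//; congr Num.sqrt.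
by rewrite mulr_sumr; apply: eq_bigr => i _; rewrite mxE exprMn.
Qed.

Lemma ler_enormD x y : enorm (x + y) <= enorm x + enorm y.
Proof.
rewrite -[leRHS]ger0_norm ?addr_ge0 ?enorm_ge0// -sqrtr_sqr ler_sqrt ?sqr_ge0//.
rewrite sqrrD !sqr_enorm.
have -> : \sum_i (x + y) 0 i ^+ 2 = \sum_i x 0 i ^+ 2 +
    (\sum_i x 0 i * y 0 i) *+ 2 + \sum_i y 0 i ^+ 2.
  by rewrite -sumrMnl -!big_split; apply: eq_bigr => i _; rewrite mxE /= sqrrD.
rewrite lerD2r lerD2l lerMn2r/=.
by apply: le_trans (ler_norm _) _; exact: cauchy_schwarz.
Qed.

Lemma ler_enormB x y z : enorm (x - z) <= enorm (x - y) + enorm (y - z).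
Proof.
by apply: le_trans (ler_enormD _ _); rewrite addrA subrK.
Qed.

Lemma ler_coord_enorm x i : `|x 0 i| <= enorm x.
Proof.
rewrite -sqrtr_sqr ler_sqrt; last by apply: sumr_ge0 => j _; exact: sqr_ge0.
by rewrite (bigD1 i)//= lerDl sumr_ge0// => j _; exact: sqr_ge0.
Qed.

Lemma enorm_le_coord x (r : R) : 0 <= r -> (forall i, `|x 0 i| <= r) ->
  enorm x <= d%:R * r.
Proof.
move=> r0 xr; rewrite -[leRHS]ger0_norm ?mulr_ge0// -sqrtr_sqr.
rewrite ler_sqrt ?sqr_ge0// exprMn.
have -> : d%:R ^+ 2 * r ^+ 2 = \sum_(i < d) (d%:R * r ^+ 2).
  by rewrite sumr_const card_ord -[RHS]mulr_natl expr2 mulrA.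
apply: ler_sum => i _; rewrite -[X in _ <= X]/(d%:R * r ^+ 2).
rewrite -[x 0 i ^+ 2]mul1r ler_pM ?ler01 ?sqr_ge0//.
  by rewrite ler1n; case: d i => // -[].
by rewrite -real_normK ?num_real// lerXn2r ?nnegrE.
Qed.

Lemma measurable_enorm : measurable_fun [set: 'rV[R]_d] (@enorm R d).
Proof.
apply: measurableT_comp => //.
  exact: (continuous_measurable_fun (@sqrt_continuous R)).
apply: measurable_sum => i.
exact: (measurable_funX 2 (measurable_coord i)).
Qed.

Lemma bounded_set_enorm (Q : set 'rV[R]_d) : bounded_set Q ->
  exists2 r, 0 < r & forall x, Q x -> enorm x <= r.
Proof.
move=> [M [_ /(_ (Num.max M 1 + 1))]]; have M1 : 1 <= Num.max M 1.
  by rewrite le_max lexx orbT.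
have -> : M < Num.max M 1 + 1 by rewrite ltr_pwDr// le_max lexx.
move=> /(_ isT) QM; exists (d%:R * (Num.max M 1 + 1) + 1).
  by rewrite ltr_wpDl// mulr_ge0//; lra.
move=> x /QM xM; apply: (@le_trans _ _ (d%:R * (Num.max M 1 + 1))); last lra.
apply: enorm_le_coord; first lra.
move=> i; apply: le_trans xM.
rewrite [leRHS]/Num.Def.normr/= mx_normrE.
exact: (le_bigmax _ (fun j : 'I_1 * 'I_d => `|x j.1 j.2|) (0, i)).
Qed.

End euclidean_norm.


(** * Finiteness of Gaussian integrals in any dimension *)

Section gaussian_integral.
Context {R : realType}.
Local Open Scope ereal_scope.

Definition gauss {d} (a : R) (y : 'rV[R]_d) : R := expR (- (a * enorm y ^+ 2)).

Lemma measurable_gauss d a : measurable_fun [set: 'rV[R]_d] (gauss a).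
Proof.
apply: measurableT_comp => //; apply: measurableT_comp => //.
apply: measurable_funM => //; apply: measurable_funX.
exact: measurable_enorm.
Qed.

Lemma integral_lebesgue_rVS n (f : 'rV[R]_n.+1 -> \bar R) :
  measurable_fun [set: 'rV[R]_n.+1] f -> (forall x, 0 <= f x) ->
  \int[lebesgue_rV n.+1]_x f x =
  \int[@lebesgue_measure R]_x \int[lebesgue_rV n]_y f (rV_cons (x, y)).
Proof.
move=> mf f0.
transitivity (\int[pushforward (@lebesgue_measure R \x lebesgue_rV n)
   (@rV_cons R n)]_x f x).
  exact: (@eq_measure_integral _ _ _ _
    (measure_function_pushforward__canonical__measure_function_Measure
       (@lebesgue_measure R \x lebesgue_rV n) (@rV_cons_measurable R n))).
rewrite (ge0_integral_pushforward (@rV_cons_measurable R n))//.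
rewrite preimage_setT fubini_tonelli1//.
  exact: measurableT_comp mf (@rV_cons_measurable _ n).
by move=> x; exact: f0.
Qed.

Lemma gaussS n a (x : R) (y : 'rV[R]_n) :
  gauss a (rV_cons (x, y)) = (expR (- (a * x ^+ 2)) * gauss a y)%R.
Proof.
rewrite /gauss !sqr_enorm -expRD; congr expR.
rewrite -opprD -mulrDr; congr (- (_ * _))%R.
rewrite /rV_cons (@big_split_ord _ _ _ 1%N n) big_ord1; congr (_ + _)%R.
  by rewrite (@row_mxEl _ 1%N 1%N n) mxE eqxx mulr1n.
by apply: eq_bigr => i _; rewrite (@row_mxEr _ 1%N 1%N n).
Qed.

Lemma gauss_ge0 d a (y : 'rV[R]_d) : (0 <= gauss a y)%R.
Proof. exact: expR_ge0. Qed.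

Lemma integral_gauss1_lty (a : R) : (0 < a)%R ->
  \int[@lebesgue_measure R]_x (expR (- (a * x ^+ 2)))%:E < +oo.
Proof.
(* [s] is the standard deviation for which the centred normal density is a multiple of e^(-a
   x^2). *)
move=> a0; pose s := Num.sqrt (2 * a)^-1%R.
have a2 : (0 < 2 * a)%R by rewrite mulr_gt0.
have s0 : s != 0%R by rewrite gt_eqF// sqrtr_gt0 invr_gt0.
have p0 := normal_peak_gt0 s0.
rewrite [X in X < _](_ : _ = \int[@lebesgue_measure R]_x
    ((normal_peak s)^-1%:E * (normal_pdf 0 s x)%:E)); last first.
  apply: eq_integral => x _; rewrite normal_pdfE// -EFinM mulKf ?gt_eqF//.
  congr (expR _)%:E; rewrite subr0 /s sqr_sqrtr ?invr_ge0 ?ltW//.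
  by field; rewrite gt_eqF.
rewrite ge0_integralZl//; last 3 first.
- by apply/measurable_EFinP; exact: measurable_normal_pdf.
- by move=> x _; rewrite lee_fin normal_pdf_ge0.
- by rewrite lee_fin invr_ge0 ltW.
by rewrite integral_normal_pdf mule1 ltry.
Qed.

Lemma integral_gauss_lty d (a : R) : (0 < a)%R ->
  \int[lebesgue_rV d]_y (gauss a y)%:E < +oo.
Proof.
move=> a0; elim: d => [|n IHn].
  rewrite integral_dirac ?diracT ?mul1e ?ltry//.
  by apply/measurable_EFinP; exact: measurable_gauss.
rewrite integral_lebesgue_rVS; last 2 first.
- by apply/measurable_EFinP; exact: measurable_gauss.
- by move=> x; rewrite lee_fin gauss_ge0.
have IH : \int[lebesgue_rV n]_y (gauss a y)%:E \is a fin_num.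
  by rewrite ge0_fin_numE// integral_ge0// => y _; rewrite lee_fin gauss_ge0.
have intE x : \int[lebesgue_rV n]_y (gauss a (rV_cons (x, y)))%:E =
    (expR (- (a * x ^+ 2)))%:E * \int[lebesgue_rV n]_y (gauss a y)%:E.
  under eq_integral => y _ do rewrite gaussS EFinM.
  rewrite ge0_integralZl// ?lee_fin ?expR_ge0//.
    by apply/measurable_EFinP; exact: measurable_gauss.
  by move=> y _; rewrite lee_fin gauss_ge0.
under eq_integral => x _ do rewrite intE.
have mg1 : measurable_fun [set: R] (fun x : R => (expR (- (a * x ^+ 2)))%:E).
  apply/measurable_EFinP; apply: measurableT_comp => //.
  by apply: measurableT_comp => //; apply: measurable_funM.
have I0 : 0 <= \int[lebesgue_rV n]_y (gauss a y)%:E.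
  by rewrite integral_ge0// => y _; rewrite lee_fin gauss_ge0.
have e0 (x : R) : [set: R] x -> 0 <= (expR (- (a * x ^+ 2)))%:E.
  by rewrite lee_fin expR_ge0.
rewrite -(fineK IH) ge0_integralZr ?fineK// lte_mul_pinfty ?integral_ge0//.
by rewrite ge0_fin_numE ?integral_ge0// integral_gauss1_lty.
Qed.

End gaussian_integral.

(** * Mean value inequality for the Euclidean gradient *)

Section mean_value.
Context {R : realType} {d : nat}.
Implicit Types (h : 'rV[R]_d -> R) (x y z v : 'rV[R]_d).

Lemma diff_gradE h z v : differentiable h z ->
  'd h z v = \sum_i v 0 i * grad h z 0 i.
Proof.
move=> hz; rewrite {1}(row_sum_delta v) linear_sum; apply: eq_bigr => i _.
by rewrite linearZ/= mxE deriveE.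
Qed.

Lemma le_diff_grad h z v : differentiable h z ->
  `|'d h z v| <= enorm (grad h z) * enorm v.
Proof.
move=> hz; rewrite diff_gradE// mulrC; exact: cauchy_schwarz.
Qed.

(** The one-dimensional mean value theorem along the segment. The gradient bound is asked on the
    segment only, because the majorant used for K later is uniform only on a ball. *)
Lemma grad_mean_value h (K : R) x y : (forall z, differentiable h z) ->
  (forall t : R, 0 <= t <= 1 -> enorm (grad h (x + t *: (y - x))) <= K) ->
  `|h y - h x| <= K * enorm (y - x).
Proof.
move=> dh hK; pose l (t : R) := x + t *: (y - x).
have dl (t : R) : is_diff t l ( *:%R ^~ (y - x)).
  rewrite /l (_ : *:%R^~ (y - x) = 0 + *:%R ^~ (y - x)); last by rewrite add0r.
  exact: (is_diffD (is_diff_cst x t) (is_diff_scalel t (y - x))).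
have dhl (t : R) : is_derive t (1 : R) (h \o l) ('d h (l t) (y - x)).
  have dh' : is_diff (l t) h ('d h (l t)) by exact: DiffDef.
  have [dc ec] := is_diff_comp (dl t) dh'.
  apply: DeriveDef; first exact/derivable1_diffP.
  by rewrite deriveE// ec/= scale1r.
have cl : {within `[0, 1], continuous (h \o l)}.
  apply: continuous_subspaceT => t; apply: differentiable_continuous.
  by apply/derivable1_diffP; case: (dhl t).
have [c c01] := @MVT R (h \o l) (fun t => 'd h (l t) (y - x)) 0 1 ltr01
  (fun t _ => dhl t) cl.
rewrite /= /l scale1r scale0r addr0 (addrC x (y - x)) subrK subr0 mulr1 => ->.
apply: le_trans (le_diff_grad _ (dh _)) _; rewrite ler_wpM2r ?enorm_ge0//.
by apply: hK; rewrite in_itv/= in c01; case/andP: c01 => /ltW -> /ltW ->.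
Qed.

End mean_value.

(** * Gaussian majorants that do not depend on the starting point *)

Section kernel_bounds.
Context {R : realType} {d : nat}.
Implicit Types (x y z : 'rV[R]_d) (a l r b : R).

(** From |y|^2 <= 2 |x|^2 + 2 |x - y|^2: at half the rate, one Gaussian centred at 0 dominates all
    those centred in the ball of radius r. This makes the later constants independent of x. *)
Lemma gauss_shift l r x y : 0 < l -> enorm x <= r ->
  expR (- (l * enorm (x - y) ^+ 2)) <= expR (l * r ^+ 2) * gauss (l / 2) y.
Proof.
move=> l0 xr; rewrite /gauss -expRD ler_expR.
have x0 := enorm_ge0 x; have xy0 := enorm_ge0 (x - y); have y0 := enorm_ge0 y.
have yxy : enorm y <= enorm x + enorm (x - y).
  by have := ler_enormD x (- (x - y)); rewrite enormN opprB addrC subrK.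
have h1 : enorm y ^+ 2 <= (enorm x + enorm (x - y)) ^+ 2.
  by rewrite lerXn2r ?nnegrE ?addr_ge0.
have h2 : enorm y ^+ 2 <= 2 * enorm x ^+ 2 + 2 * enorm (x - y) ^+ 2.
  apply: le_trans h1 _; rewrite -subr_ge0.
  rewrite (_ : _ - _ = (enorm x - enorm (x - y)) ^+ 2) ?sqr_ge0//.
  by ring.
have h3 : enorm x ^+ 2 <= r ^+ 2.
  by rewrite lerXn2r ?nnegrE// (le_trans x0).
have h4 : l * enorm y ^+ 2 <= l * (2 * r ^+ 2 + 2 * enorm (x - y) ^+ 2).
  by rewrite ler_pM2l//; apply: le_trans h2 _; rewrite lerD2r ler_pM2l.
clear -h4; lra.
Qed.

(** Completing the square: half of the Gaussian exponent absorbs the linear growth. *)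
Lemma expR_mul_gauss a b y : 0 < a ->
  expR (b * enorm y) * gauss a y <= expR (b ^+ 2 / (2 * a)) * gauss (a / 2) y.
Proof.
move=> a0; rewrite /gauss -!expRD ler_expR.
have -> : b ^+ 2 / (2 * a) - a / 2 * enorm y ^+ 2 =
    b * enorm y - a * enorm y ^+ 2 + (2 * a)^-1 * (b - a * enorm y) ^+ 2.
  by field; rewrite gt_eqF.
by rewrite lerDl mulr_ge0 ?sqr_ge0// invr_ge0 mulr_ge0// ltW.
Qed.

Definition growth (L : R) y := L * (enorm y + 1).

Lemma measurable_growth L : measurable_fun [set: 'rV[R]_d] (growth L).
Proof.
apply: measurable_funM => //; apply: measurable_funD => //.
exact: measurable_enorm.
Qed.

Lemma growth_ge0 L y : 0 < L -> 0 <= growth L y.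
Proof. by move=> L0; rewrite mulr_ge0 ?addr_ge0 ?enorm_ge0// ltW. Qed.

Lemma integrable_expR_growth c a : 0 < a ->
  (lebesgue_rV d).-integrable [set: 'rV[R]_d]
    (fun y => (expR (growth c y) * gauss a y)%:E).
Proof.
move=> a0; apply: (@le_integrable _ _ _ _ _ measurableT _
    (fun y => (expR (c + c ^+ 2 / (2 * a)))%:E * (gauss (a / 2) y)%:E)%E).
- apply/measurable_EFinP; apply: measurable_funM; last exact: measurable_gauss.
  by apply: measurableT_comp => //; exact: measurable_growth.
- move=> y _; rewrite -EFinM lee_fin !ger0_norm ?mulr_ge0 ?expR_ge0//.
  rewrite /growth mulrDr mulr1 addrC !expRD -!mulrA ler_wpM2l ?expR_ge0//.
  by rewrite (mulrA c) -expr2 expR_mul_gauss.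
- apply: integrableZl => //; apply/integrableP; split.
    by apply/measurable_EFinP; exact: measurable_gauss.
  under eq_integral do rewrite gee0_abs ?lee_fin ?gauss_ge0//.
  by apply: integral_gauss_lty; rewrite divr_gt0.
Qed.

(** The exponential of the growth is integrated, rather than the growth, so that one family of
    integrals controls means, Lipschitz constants and exponential moments; the first two use u <=
    e^u. *)
Definition growth_mass c a : R :=
  \int[lebesgue_rV d]_y (expR (growth c y) * gauss a y).

Lemma growth_mass_ge0 c a : 0 <= growth_mass c a.
Proof. by apply: Rintegral_ge0 => y _; rewrite mulr_ge0 ?expR_ge0. Qed.

End kernel_bounds.

(** * Mean, Lipschitz constant and exponential moments of one transition *)

Section density.
Context {R : realType} {d : nat}.
Variables (L l1 l2 r : R).
Hypotheses (l10 : 0 < l1) (l20 : 0 < l2).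

Local Notation leb := (lebesgue_rV d).
Local Notation mass := (@growth_mass R d).

Definition mean_bound : R := l1^-1 * expR (l1 * r ^+ 2) * mass L (l1 / 2).

Definition mean_lipschitz : R := l2^-1 * expR (l2 * r ^+ 2) * mass L (l2 / 2).

(** With u = [W y - g x], the bounds u^2 e^|u| <= 4 e^(2 |u|) and |u| <= [growth L y + mean_bound]
    account for the factor 4, the exponent [2 * mean_bound] and the doubled growth constant. *)
Definition mgf_bound : R :=
  4 * expR (2 * mean_bound) * (l1^-1 * expR (l1 * r ^+ 2)) * mass (2 * L) (l1 / 2).

Lemma mean_bound_ge0 : 0 <= mean_bound.
Proof. by rewrite !mulr_ge0 ?expR_ge0 ?growth_mass_ge0 ?invr_ge0// ltW. Qed.

Lemma mean_lipschitz_ge0 : 0 <= mean_lipschitz.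
Proof. by rewrite !mulr_ge0 ?expR_ge0 ?growth_mass_ge0 ?invr_ge0// ltW. Qed.

Lemma mgf_bound_ge0 : 0 <= mgf_bound.
Proof. by rewrite !mulr_ge0 ?expR_ge0 ?growth_mass_ge0 ?invr_ge0// ltW. Qed.

Variable p : 'rV[R]_d -> 'rV[R]_d -> R.
Hypothesis mp : forall x, measurable_fun [set: 'rV[R]_d] (p x).
Hypothesis p0 : forall x y, 0 <= p x y.
Hypothesis p1 : forall x, (\int[leb]_y (p x y)%:E = 1)%E.
Hypothesis p_le : forall x y,
  `|p x y| <= l1^-1 * expR (- (l1 * enorm (x - y) ^+ 2)).
Hypothesis p_diff : forall x y, differentiable (p ^~ y) x /\
  enorm (grad (p ^~ y) x) <= l2^-1 * expR (- (l2 * enorm (x - y) ^+ 2)).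

Variable W : 'rV[R]_d -> R.
Hypothesis mW : measurable_fun [set: 'rV[R]_d] W.
Hypothesis W_le : forall y, `|W y| <= growth L y.

Let g x : R := \int[leb]_y (W y * p x y).

Let p_gauss x y : enorm x <= r ->
  p x y <= l1^-1 * expR (l1 * r ^+ 2) * gauss (l1 / 2) y.
Proof.
move=> xr; apply: le_trans (ler_norm _) _; apply: le_trans (p_le _ _) _.
by rewrite -mulrA ler_pM2l ?invr_gt0// gauss_shift.
Qed.

Let le_expR (u : R) : u <= expR u.
Proof. by apply: le_trans (expR_ge1Dx u); rewrite lerDr. Qed.

Let Wp_le x y : enorm x <= r -> `|W y * p x y| <=
  l1^-1 * expR (l1 * r ^+ 2) * (expR (growth L y) * gauss (l1 / 2) y).
Proof.
move=> xr; rewrite normrM (ger0_norm (p0 x y)) mulrCA ler_pM//; last exact: p_gauss.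
exact: le_trans (W_le y) (le_expR _).
Qed.

Let mWp x : measurable_fun [set: 'rV[R]_d] (fun y => W y * p x y).
Proof. exact: measurable_funM. Qed.

Let integrable_mass c a K : 0 < a -> leb.-integrable [set: 'rV[R]_d]
  (EFin \o (fun y => K * (expR (growth c y) * gauss a y))).
Proof.
by move=> a0; exact: (integrableZl measurableT K (integrable_expR_growth c a0)).
Qed.

Lemma integrable_Wp x : enorm x <= r ->
  leb.-integrable [set: 'rV[R]_d] (EFin \o (fun y => W y * p x y)).
Proof.
move=> xr; have a0 : 0 < l1 / 2 by rewrite divr_gt0.
apply: (le_integrable measurableT _ _
   (integrable_mass L (l1^-1 * expR (l1 * r ^+ 2)) a0)).
  by apply/measurable_EFinP; exact: mWp.
by move=> y _; rewrite /= lee_fin (le_trans (Wp_le _ _))// ler_norm.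
Qed.

Lemma integrable_density x : leb.-integrable [set: 'rV[R]_d] (EFin \o p x).
Proof.
apply/integrableP; split; first by apply/measurable_EFinP; exact: mp.
under eq_integral do rewrite /= ger0_norm//.
by rewrite p1 ltry.
Qed.

Lemma mean_le x : enorm x <= r -> `|g x| <= mean_bound.
Proof.
move=> xr; have iW := integrable_Wp xr.
apply: le_trans (le_normr_Rintegral measurableT iW) _.
rewrite /mean_bound /growth_mass -RintegralZl//; last first.
  by apply: integrable_expR_growth; rewrite divr_gt0.
apply: le_Rintegral => //; first exact: integrable_norm.
  by apply: integrable_mass; rewrite divr_gt0.
by move=> y _; exact: Wp_le.
Qed.

Let p_lipschitz x x' y : enorm x <= r -> enorm x' <= r ->
  `|p x y - p x' y| <=
    l2^-1 * expR (l2 * r ^+ 2) * gauss (l2 / 2) y * enorm (x - x').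
Proof.
move=> xr x'r; apply: (@grad_mean_value _ _ (p ^~ y)) => [z|t /andP[t0 t1]].
  by have [] := p_diff z y.
have [_] := p_diff (x' + t *: (x - x')) y; move=> /le_trans; apply.
rewrite -mulrA ler_pM2l ?invr_gt0// gauss_shift//.
have -> : x' + t *: (x - x') = t *: x + (1 - t) *: x'.
  by rewrite scalerBl scalerBr scale1r addrCA.
apply: le_trans (ler_enormD _ _) _; rewrite !enormZ !ger0_norm ?subr_ge0//.
have h1 : t * enorm x <= t * r by rewrite ler_wpM2l.
have h2 : (1 - t) * enorm x' <= (1 - t) * r by rewrite ler_wpM2l// subr_ge0.
by have := lerD h1 h2; rewrite -mulrDl (addrC t) subrK mul1r.
Qed.

Lemma mean_lip x x' : enorm x <= r -> enorm x' <= r ->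
  `|g x - g x'| <= mean_lipschitz * enorm (x - x').
Proof.
move=> xr x'r; have iW := integrable_Wp xr; have iW' := integrable_Wp x'r.
rewrite /g -RintegralB//; have iB := integrableB measurableT iW iW'.
apply: le_trans (le_normr_Rintegral measurableT iB) _.
rewrite /mean_lipschitz /growth_mass mulrAC.
rewrite -RintegralZl//; last first.
  by apply: integrable_expR_growth; rewrite divr_gt0.
apply: le_Rintegral => //; first exact: integrable_norm.
  by apply: integrable_mass; rewrite divr_gt0.
move=> y _; rewrite -mulrBr normrM.
rewrite [leRHS](_ : _ = expR (growth L y) *
   (l2^-1 * expR (l2 * r ^+ 2) * gauss (l2 / 2) y * enorm (x - x'))); last ring.
by rewrite ler_pM//; [exact: le_trans (W_le y) (le_expR _)|exact: p_lipschitz].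
Qed.

(** The linear term integrates to zero, [g x] being the mean of W under [p x], and what remains is 1
    + [mgf_bound] th^2. The condition [|th| <= 1] gives the quadratic remainder an integrable
    majorant in which th enters only as the factor th^2. *)
Lemma mgf_le x (th : R) : enorm x <= r -> `|th| <= 1 ->
  (\int[leb]_y (expR (th * (W y - g x)) * p x y)%:E <=
   (expR (mgf_bound * th ^+ 2))%:E)%E.
Proof.
move=> xr th1; set K := l1^-1 * expR (l1 * r ^+ 2).
have l12 : 0 < l1 / 2 by rewrite divr_gt0.
pose F y := expR (th * (W y - g x)) * p x y.
pose E (y : 'rV[R]_d) := expR (growth (2 * L) y) * gauss (l1 / 2) y.
pose c := 4 * expR (2 * mean_bound) * K.
(* The majorant of the integrand: the density, the linear term, its centring, and the quadratic
   remainder with the density replaced by its Gaussian bound. *)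
pose H y := p x y + th * (W y * p x y) + - (th * g x) * p x y + th ^+ 2 * c * E y.
have ip := integrable_density x; have iW := integrable_Wp xr.
have iE : leb.-integrable [set: 'rV[R]_d] (EFin \o E).
  exact: integrable_expR_growth.
have iZ (f : 'rV[R]_d -> R) k : leb.-integrable [set: 'rV[R]_d] (EFin \o f) ->
    leb.-integrable [set: 'rV[R]_d] (EFin \o (fun y => k * f y)).
  by move=> if_; exact: (integrableZl measurableT k if_).
have iD (f f' : 'rV[R]_d -> R) : leb.-integrable [set: 'rV[R]_d] (EFin \o f) ->
    leb.-integrable [set: 'rV[R]_d] (EFin \o f') ->
    leb.-integrable [set: 'rV[R]_d] (EFin \o (fun y => f y + f' y)).
  by move=> if_ if'; exact: (integrableD measurableT if_ if').
have i1 := iD _ _ ip (iZ _ th iW).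
have i2 := iD _ _ i1 (iZ _ (- (th * g x)) ip).
have iH : leb.-integrable [set: 'rV[R]_d] (EFin \o H).
  exact: (iD _ _ i2 (iZ _ (th ^+ 2 * c) iE)).
have ep : \int[leb]_y p x y = 1 by rewrite /Rintegral p1.
have eH : \int[leb]_y H y = 1 + mgf_bound * th ^+ 2.
  rewrite /H (RintegralD measurableT i2 (iZ _ (th ^+ 2 * c) iE)).
  rewrite (RintegralD measurableT i1 (iZ _ (- (th * g x)) ip)).
  rewrite (RintegralD measurableT ip (iZ _ th iW)) !RintegralZl// ep.
  rewrite mulr1 addrK /mgf_bound -/K -/c; congr (_ + _).
  by rewrite -mulrA mulrC.
have FH y : F y <= H y.
  pose u := W y - g x.
  have u1 : `|u| <= growth L y + mean_bound.
    by apply: le_trans (ler_normB _ _) _; rewrite lerD// mean_le.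
  have u2 : u ^+ 2 <= 4 * expR `|u|.
    rewrite -real_normK ?num_real//.
    have h : `|u| / 2 <= expR (`|u| / 2) by exact: le_expR.
    have h2 : (`|u| / 2) ^+ 2 <= expR (`|u| / 2) ^+ 2.
      by rewrite lerXn2r ?nnegrE ?expR_ge0// divr_ge0.
    rewrite -expRM_natl (mulrC 2) divfK// in h2.
    rewrite -[leLHS](_ : 4 * (`|u| / 2) ^+ 2 = _) ?ler_pM2l//.
    by rewrite exprMn exprVn -natrX mulrCA divff ?mulr1// pnatr_eq0.
  have u3 : `|th * u| <= `|u| by rewrite normrM ler_piMl.
  have e2 : (th * u) ^+ 2 * expR `|th * u| <=
      th ^+ 2 * (4 * expR (2 * mean_bound) * expR (growth (2 * L) y)).
    rewrite [(th * u) ^+ 2]exprMn -[leLHS]mulrA.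
    apply: ler_wpM2l; first exact: sqr_ge0.
    apply: (@le_trans _ _ (4 * expR `|u| * expR `|u|)).
      by rewrite ler_pM ?sqr_ge0 ?expR_ge0// ler_expR.
    rewrite -!mulrA ler_pM2l// -!expRD ler_expR.
    have -> : growth (2 * L) y = 2 * growth L y by rewrite /growth mulrA.
    have -> : `|u| + `|u| = 2 * `|u| by ring.
    by rewrite -mulrDr ler_pM2l// addrC.
  have e1 := expR_le_sqr_exp (th * u).
  have e3 : expR (th * u) <= 1 + th * u +
      th ^+ 2 * (4 * expR (2 * mean_bound) * expR (growth (2 * L) y)).
    by apply: le_trans e1 _; rewrite lerD2l.
  apply: (le_trans (ler_wpM2r (p0 x y) e3)).
  have -> : H y = (1 + th * u) * p x y + th ^+ 2 * (c * E y).
    by rewrite /H /u; ring.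
  rewrite mulrDl lerD2l -[leLHS]mulrA; apply: ler_wpM2l; first exact: sqr_ge0.
  have -> : c * E y = 4 * expR (2 * mean_bound) * expR (growth (2 * L) y) *
      (K * gauss (l1 / 2) y) by rewrite /c /E; ring.
  by apply: ler_wpM2l; [rewrite !mulr_ge0 ?expR_ge0|exact: p_gauss].
have mF : measurable_fun [set: 'rV[R]_d] F.
  apply: measurable_funM => //; apply: measurableT_comp => //.
  by apply: measurable_funM => //; exact: measurable_funB.
have F0 y : 0 <= F y by rewrite mulr_ge0 ?expR_ge0.
have iF : leb.-integrable [set: 'rV[R]_d] (EFin \o F).
  apply: (le_integrable measurableT _ _ iH); first exact/measurable_EFinP.
  move=> y _; rewrite /= lee_fin (ger0_norm (F0 y)).
  exact: le_trans (FH y) (ler_norm _).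
rewrite -[leLHS]fineK; last exact: (integrable_fin_num measurableT iF).
rewrite lee_fin; apply: le_trans (le_Rintegral measurableT iF iH _) _ => //.
by rewrite eH expR_ge1Dx.
Qed.

End density.

(** * Change of measure and conditional densities *)

Section integral_density.
Context d (T : measurableType d) (R : realType).
Variables (mu nu : {measure set T -> \bar R}) (h : T -> R).
Hypotheses (mh : measurable_fun [set: T] h) (h0 : forall x, 0 <= h x).
Hypothesis nuE : forall A, measurable A ->
  (nu A = \int[mu]_(x in A) (h x)%:E)%E.
Local Open Scope ereal_scope.
Import HBNNSimple.

(** On simple functions this is the hypothesis [nuE]; monotone convergence does the rest. The two
    measures are general because the lemma serves restrictions (an indicator as density), laws of
    the sample and joint laws alike. *)
Lemma integral_density (f : T -> \bar R) : measurable_fun [set: T] f ->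
  (forall x, 0 <= f x) -> \int[nu]_x f x = \int[mu]_x (f x * (h x)%:E).
Proof.
move=> mf f0; pose g := nnsfun_approx measurableT mf.
have mgh n : measurable_fun [set: T] (fun x => (g n x * h x)%:E).
  by apply/measurable_EFinP; exact: measurable_funM.
have -> : \int[nu]_x f x = limn (fun n => \int[nu]_x (g n x)%:E).
  rewrite -monotone_convergence//.
  - by apply: eq_integral => x _; apply/esym/cvg_lim => //; exact: cvg_nnsfun_approx.
  - by move=> n; exact/measurable_EFinP/measurable_funP.
  - by move=> n x _; rewrite lee_fin.
  - by move=> x _ m n mn; rewrite lee_fin; exact/lefP/nd_nnsfun_approx.
have -> : \int[mu]_x (f x * (h x)%:E) =
    limn (fun n => \int[mu]_x (g n x * h x)%:E).
  rewrite -monotone_convergence//.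
  - apply: eq_integral => x _; apply/esym/cvg_lim => //.
    rewrite (_ : (fun n => _) = (fun n => (g n x)%:E * (h x)%:E))//.
    by apply: cvgeZr; [|exact: cvg_nnsfun_approx].
  - by move=> n x _; rewrite lee_fin mulr_ge0.
  - move=> x _ m n mn; rewrite lee_fin ler_wpM2r//.
    exact/lefP/nd_nnsfun_approx.
congr (limn _); apply/funext => n.
have indE (k : {measure set T -> \bar R}) (u : T -> R) r : measurable_fun [set: T] u ->
    (forall x, 0 <= u x)%R -> (0 <= r)%R ->
    \int[k]_x (r * \1_(g n @^-1` [set r]) x * u x)%:E =
    r%:E * \int[k]_(x in g n @^-1` [set r]) (u x)%:E.
  move=> mu_ u0 r0; rewrite [in RHS]integral_mkcond -ge0_integralZl//.
  - apply: eq_integral => x _; rewrite /patch indicE; case: ifPn => xr.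
      by rewrite mulr1 EFinM.
    by rewrite mulr0 mul0r mule0.
  - by apply/(measurable_restrictT _ _).1 => //; apply: measurable_funTS;
      exact/measurable_EFinP.
  - by move=> x _; rewrite /patch; case: ifPn => //; rewrite lee_fin.
transitivity (\sum_(r \in range (g n))
    \int[nu]_x (r * \1_(g n @^-1` [set r]) x)%:E).
  rewrite -ge0_integral_fsum//.
  - by apply: eq_integral => x _; rewrite fsumEFin// -fimfunE.
  - by move=> r; exact/measurable_EFinP/measurable_funM.
  - by move=> r x _; rewrite nnfun_muleindic_ge0.
transitivity (\sum_(r \in range (g n))
    \int[mu]_x (r * \1_(g n @^-1` [set r]) x * h x)%:E); last first.
  rewrite -ge0_integral_fsum//.
  - apply: eq_integral => x _; rewrite [in RHS](fimfunE (g n)) EFinM.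
    rewrite -fsumEFin// ge0_mule_fsuml//.
    by move=> r; exact: nnfun_muleindic_ge0.
  - move=> r; apply/measurable_EFinP; apply: measurable_funM => //.
    exact: measurable_funM.
  - by move=> r x _; rewrite EFinM mule_ge0 ?nnfun_muleindic_ge0 ?lee_fin.
apply: eq_fsbigr => r; rewrite inE => -[x _ <-].
rewrite indE// -nuE//.
under eq_integral do rewrite -[X in X%:E]mulr1.
by rewrite (indE nu (fun=> 1%R))// integral_cst// mul1e.
Qed.

End integral_density.

Section density_measure.
Context d (T : measurableType d) (R : realType).
Variables (mu : {measure set T -> \bar R}) (h : T -> R).
Hypotheses (mh : measurable_fun [set: T] h) (h0 : forall x, 0 <= h x).
Local Open Scope ereal_scope.

Definition density_measure (A : set T) : \bar R := \int[mu]_(x in A) (h x)%:E.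

Let density0 : density_measure set0 = 0.
Proof. exact: integral_set0. Qed.

Let density_ge0 A : 0 <= density_measure A.
Proof. by apply: integral_ge0 => x _; rewrite lee_fin. Qed.

Let density_sigma_additive : semi_sigma_additive density_measure.
Proof.
move=> A mA tA mUA; rewrite /density_measure ge0_integral_bigcup//.
- apply: is_cvg_ereal_nneg_natsum_cond => n _ _; exact: density_ge0.
- by apply: measurable_funTS; exact/measurable_EFinP.
- by move=> x _; rewrite lee_fin.
Qed.

HB.instance Definition _ := isMeasure.Build _ _ _
  density_measure density0 density_ge0 density_sigma_additive.

Definition measure_of_density : {measure set T -> \bar R} := density_measure.

End density_measure.

Section conditional_density.
Context d d1 d2 (Omega : measurableType d) (T : measurableType d1)
  (S : measurableType d2) (R : realType).
Variables (P : probability Omega R) (m : {sigma_finite_measure set S -> \bar R}).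
Variables (U : {mfun Omega >-> T}) (Y : {mfun Omega >-> S}) (h : T * S -> R).
Variable G : set (set T).
Hypotheses (mh : measurable_fun [set: T * S] h) (h0 : forall z, 0 <= h z)
  (mG : @measurable _ T = <<s G >>)
  (GI : setI_closed G) (GT : G [set: T]).
Local Open Scope ereal_scope.
Hypothesis UYE : forall A B, G A -> measurable B ->
  P (U @^-1` A `&` Y @^-1` B) =
  \int[P]_(w in U @^-1` A) \int[m]_(y in B) (h (U w, y))%:E.

Let rect : set (set (T * S)) := [set A `*` B | A in G & B in measurable].

Let measurable_rect : @measurable _ (T * S)%type = <<s rect >>.
Proof.
rewrite measurable_prod_measurableType eqEsubset; split; last first.
  apply: smallest_sub; first exact: smallest_sigma_algebra.
  move=> _ [A GA] [B mB] <-; apply: sub_sigma_algebra.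
  by exists A => //; [rewrite mG; exact: sub_sigma_algebra|exists B].
apply: smallest_sub; first exact: smallest_sigma_algebra.
move=> _ [A mA] [B mB] <-.
have mf : measurable_fun [set: g_sigma_algebraType rect] (fst : T * S -> T).
  apply: (measurability G mG) => _ [C GC <-]; rewrite setTI.
  apply: sub_sigma_algebra; exists C => //; exists setT => //.
  by rewrite setXT.
have ms : measurable_fun [set: g_sigma_algebraType rect] (snd : T * S -> S).
  move=> _ C mC; rewrite setTI; apply: sub_sigma_algebra.
  by exists setT => //; exists C => //; rewrite setTX.
have -> : A `*` B = (fst @^-1` A) `&` (snd @^-1` B) by [].
have := measurableI _ _ (mf measurableT A mA) (ms measurableT B mB).
by rewrite !setTI.
Qed.

Let mUY : measurable_fun [set: Omega] (fun w => (U w, Y w)).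
Proof. exact: measurable_fun_pair. Qed.

Let mUY_mixin := isMeasurableFun.Build _ _ _ _ _ mUY.
Let UY : {mfun Omega >-> (T * S)%type} := HB.pack (fun w => (U w, Y w)) mUY_mixin.

Let mu : {measure set (T * S) -> \bar R} := distribution P U \x m.

Let density_rect A B : G A -> measurable B ->
  \int[mu]_(z in A `*` B) (h z)%:E =
  \int[P]_(w in U @^-1` A) \int[m]_(y in B) (h (U w, y))%:E.
Proof.
move=> GA mB; have mA : measurable A by rewrite mG; exact: sub_sigma_algebra.
have mAB : measurable (A `*` B) by exact: measurableX.
have mhAB : measurable_fun [set: T * S] ((fun z => (h z)%:E) \_ (A `*` B)).
  apply/(measurable_restrictT (fun z => (h z)%:E) mAB).
  by apply: measurable_funTS; exact/measurable_EFinP.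
have hAB0 z : 0 <= ((fun z => (h z)%:E) \_ (A `*` B)) z.
  by rewrite /patch; case: ifPn => //; rewrite lee_fin.
rewrite integral_mkcond fubini_tonelli1//.
rewrite ge0_integral_distribution; last 2 first.
- exact: (measurable_fun_fubini_tonelli_F _ mhAB hAB0).
- move=> x; apply: integral_ge0 => y _.
  exact: hAB0.
rewrite [RHS]integral_mkcond; apply: eq_integral => w _ /=.
rewrite [RHS]/patch /fubini_F; case: ifPn => UA.
  rewrite [RHS]integral_mkcond; apply: eq_integral => y _.
  rewrite /patch in_setX; move: UA; rewrite !inE /= => UA.
  by case: (boolP (y \in B)) => yB; rewrite ?andbT ?andbF// mem_set.
apply: integral0_eq => y _; rewrite /patch in_setX /=.
have -> // : U w \in A = false.
by apply/negbTE; move: UA; apply: contra; rewrite !inE.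
Qed.

(** By [UYE] the joint law of (U, Y) agrees, on rectangles over the pi-system G, with the measure of
    density h relative to the product of the law of U and m. Finite measures that agree on a
    generating pi-system coincide, and Tonelli's theorem yields the iterated integral. *)
Lemma integral_conditional_density (f : T * S -> \bar R) :
  measurable_fun [set: T * S] f -> (forall z, 0 <= f z) ->
  \int[P]_w f (U w, Y w) = \int[P]_w \int[m]_y (f (U w, y) * (h (U w, y))%:E).
Proof.
move=> mf f0; have mfh : measurable_fun [set: T * S] (fun z => f z * (h z)%:E).
  by apply: emeasurable_funM => //; exact/measurable_EFinP.
have fh0 z : 0 <= f z * (h z)%:E by rewrite mule_ge0// lee_fin.
transitivity (\int[distribution P UY]_z f z).
  by rewrite ge0_integral_distribution.
rewrite (@integral_density _ _ _ mu _ h mh h0)//; last first.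
  move=> A mA; rewrite -[RHS]/(measure_of_density mu mh h0 A).
  apply: (measure_unique rect (fun=> setT) measurable_rect) => //.
  - move=> _ _ [A1 GA1 [B1 mB1 <-]] [A2 GA2 [B2 mB2 <-]].
    exists (A1 `&` A2); first exact: GI.
    by exists (B1 `&` B2); [exact: measurableI|rewrite setXI].
  - by move=> _; exists setT => //; exists setT => //; rewrite setXTT.
  - by rewrite bigcup_const.
  - move=> _ [A1 GA1 [B1 mB1 <-]]; rewrite /= /density_measure density_rect//.
    exact: UYE.
  - by move=> _; rewrite /= probability_setT ltry.
rewrite fubini_tonelli1// ge0_integral_distribution//.
  exact: measurable_fun_fubini_tonelli_F.
by move=> x; apply: integral_ge0 => y _.
Qed.

End conditional_density.

(** * Joint measurability of the estimates in the data and the space variable *)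

Section measurable_estimators.
Context {R : realType} {d D M mY : nat} {d1 : measure_display}
  {S : measurableType d1}.
Variables (T : R) (N k : nat).
Variables (f : 'I_D -> R -> 'rV[R]_d -> R)
  (c : 'I_D -> 'I_D -> R -> 'rV[R]_d -> R) (C : nat -> R).
Variables (xs : 'I_M -> nat -> S -> 'rV[R]_d)
  (xt : nat -> 'I_M -> 'I_mY -> S -> 'rV[R]_d).

Local Notation rV := 'rV[R]_d.

Lemma measurable_closer m (s r : 'I_M) :
  (forall s, measurable_fun [set: S] (xs s m)) ->
  measurable_fun [set: S * rV]
    (fun z : S * rV => closer (fun s m => xs s m z.1) m z.2 r s).
Proof.
move=> mxs.
have mdist q : measurable_fun [set: S * rV]
    (fun z : S * rV => enorm (xs q m z.1 - z.2)).
  apply: measurableT_comp; first exact: measurable_enorm.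
  apply: measurable_fun_rV => i; under eq_fun do rewrite !mxE.
  apply: measurable_funB.
    apply: (measurableT_comp (measurable_coord i)).
    exact: (measurableT_comp (mxs q) measurable_fst).
  exact: (measurableT_comp (measurable_coord i) measurable_snd).
rewrite /closer; apply: measurable_or; first exact: measurable_fun_ltr.
by apply: measurable_and => //; exact: measurable_fun_eqr.
Qed.

Lemma measurable_in_knn m (s : 'I_M) :
  (forall s, measurable_fun [set: S] (xs s m)) ->
  measurable_fun [set: S * rV]
    (fun z : S * rV => s \in knn k (fun s m => xs s m z.1) m z.2).
Proof.
move=> mxs; rewrite [X in measurable_fun _ X](_ : _ = (fun z : S * rV =>
    (\sum_(r < M) (if closer (fun s m => xs s m z.1) m z.2 r s
                   then 1 else 0) : R) < k%:R)); last first.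
  apply/funext => z; rewrite inE -sum1_card -(ltr_nat R) natr_sum.
  by congr (_ < _); rewrite big_mkcond.
apply: measurable_fun_ltr => //; apply: measurable_sum => r.
by apply: measurable_fun_ifT => //; exact: measurable_closer.
Qed.

Lemma measurable_sg : measurable_fun [set: R] (@Num.sg R).
Proof.
rewrite [X in measurable_fun _ X](_ : _ = (fun x : R =>
    if x == 0 then 0 else if x < 0 then -1 else 1)); last first.
  apply/funext => x; have [x0|x0|->] := ltgtP x 0.
  - by rewrite ltr0_sg// x0.
  - by rewrite gtr0_sg.
  - by rewrite sgr0.
apply: measurable_fun_ifT => //; first exact: measurable_fun_eqr.
by apply: measurable_fun_ifT => //; exact: measurable_fun_ltr.
Qed.

Lemma measurable_bigmax d2 (U : measurableType d2) (I : Type) (s : seq I)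
    (u0 : U -> R) (u : I -> U -> R) :
  measurable_fun [set: U] u0 -> (forall i, measurable_fun [set: U] (u i)) ->
  measurable_fun [set: U] (fun z => \big[Num.max/u0 z]_(i <- s) u i z).
Proof.
move=> mu0 mu; elim: s => [|i s IHs]; first by under eq_fun do rewrite big_nil.
by under eq_fun do rewrite big_cons; exact: measurable_maxr.
Qed.

Lemma measurable_g_hat_of m (W : S -> 'I_D -> rV -> R) (j : 'I_D) :
  (forall s, measurable_fun [set: S] (xs s m)) ->
  (forall s h, measurable_fun [set: S] (xt m s h)) ->
  measurable_fun [set: S * rV] (fun z : S * rV => W z.1 j z.2) ->
  measurable_fun [set: S * rV] (fun z : S * rV =>
    g_hat_of k C (fun s m => xs s m z.1) (fun m s h => xt m s h z.1) m
      (W z.1) j z.2).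
Proof.
move=> mxs mxt mW.
have mg : measurable_fun [set: S * rV] (fun z : S * rV =>
    g_tilde_of k (fun s m => xs s m z.1) (fun m s h => xt m s h z.1) m
      (W z.1) j z.2).
  rewrite /g_tilde_of; apply: measurable_funM => //.
  under eq_fun do rewrite big_mkcond.
  apply: measurable_sum => s; apply: measurable_fun_ifT => //.
    exact: measurable_in_knn.
  apply: measurable_sum => h.
  apply: (measurableT_comp mW (g := fun z : S * rV => (z.1, xt m s h z.1))).
  apply: measurable_fun_pair => //.
  exact: (measurableT_comp (mxt s h) measurable_fst).
rewrite /g_hat_of; apply: measurable_funM.
  exact: (measurableT_comp measurable_sg mg).
apply: measurable_minr; first exact: (measurableT_comp _ mg).
apply: measurable_funM => //; apply: measurable_funD => //.
exact: (measurableT_comp measurable_enorm measurable_snd).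
Qed.

(** S is left abstract because the result is needed both on [Omega] and for the sigma-algebra that
    ignores one simulation. Only times from m0 on are constrained, which is what makes the estimate
    at [t_(n+1)] blind to the simulations started at [t_n]. *)
Lemma measurable_V_hat m0 : (0 < N)%N -> 0 < T -> measurable_data T f c ->
  (forall s m, (m0 <= m < N)%N -> measurable_fun [set: S] (xs s m)) ->
  (forall s h m, (m0 <= m < N)%N -> measurable_fun [set: S] (xt m s h)) ->
  forall j, measurable_fun [set: S * rV] (fun z : S * rV =>
    V_hat T N k f c C (fun s m => xs s m z.1) (fun m s h => xt m s h z.1)
      m0 j z.2).
Proof.
move=> N0 T0 mfc mxs mxt; rewrite /V_hat.
(* Induction on the number r of steps before the horizon; r <= N - m0 keeps every time that is
   visited between m0 and N. *)
have : (N - m0 <= N - m0)%N by [].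
elim: {-2}(N - m0)%N => [|r IHr] rN j; first exact: measurable_cst.
have rN' : (m0 <= N - r.+1 < N)%N.
  rewrite ltn_subrL N0 ltn0Sn/= andbT.
  have m0N : (m0 <= N)%N by rewrite ltnW// -subn_gt0 (leq_ltn_trans _ rN).
  have m0rN : (m0 + r.+1 <= N)%N by rewrite -leq_subRL.
  by rewrite leq_subRL 1?addnC// (leq_trans _ m0rN)// leq_addl.
have t01 : 0 <= grid T N (N - r.+1) <= T.
  rewrite /grid mulr_ge0 ?divr_ge0 ?(ltW T0)//= mulrC -mulrA ger_pMr//.
  by rewrite mulrC ler_pdivrMr ?ltr0n// mul1r ler_nat leq_subr.
have [mf mc] := mfc _ t01.
have mV i : measurable_fun [set: S * rV] (fun z : S * rV =>
    T / N%:R * f i (grid T N (N - r.+1)) z.2 - c j i (grid T N (N - r.+1)) z.2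
    + g_hat_of k C (fun s m => xs s m z.1) (fun m s h => xt m s h z.1)
        (N - r.+1) (V_hat_before T N k f c C (fun s m => xs s m z.1)
          (fun m s h => xt m s h z.1) r) i z.2).
  apply: measurable_funD; first apply: measurable_funB.
  - by apply: measurable_funM => //; exact: (measurableT_comp (mf i)).
  - exact: (measurableT_comp (mc j i)).
  - apply: (measurable_g_hat_of (W := fun t => V_hat_before T N k f c C
      (fun s m => xs s m t) (fun m s h => xt m s h t) r)).
    + by move=> s; exact: mxs.
    + by move=> s h; exact: mxt.
    + by apply: IHr; exact: ltnW.
rewrite /= /best_switch; exact: measurable_bigmax.
Qed.

End measurable_estimators.

(** * The transition kernel given by the density *)

Section transition_kernel.
Context {R : realType} {d : nat}.
Variables (T : R) (N : nat) (rho : 'rV[R]_d -> R -> 'rV[R]_d -> R -> R).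
Hypothesis rhoP : transition_density T N rho.

Local Notation leb := (lebesgue_rV d).
Local Notation p m x y := (rho x (grid T N m) y (grid T N m.+1)).

Lemma measurable_density m x : (m < N)%N ->
  measurable_fun [set: 'rV[R]_d] (fun y => p m x y).
Proof.
move=> mN; have [mp _ _] := rhoP mN.
exact: (measurableT_comp mp (pair1_measurable x)).
Qed.

Lemma integral_density_le1 m x (B : set 'rV[R]_d) : (m < N)%N -> measurable B ->
  (\int[leb]_(y in B) (p m x y)%:E <= 1)%E.
Proof.
move=> mN mB; have [mp p0 p1] := rhoP mN; rewrite -(p1 x).
apply: ge0_subset_integral => //.
  by apply/measurable_EFinP; exact: measurable_density.
by move=> y _; rewrite lee_fin.
Qed.

Lemma transitionE m x (B : set 'rV[R]_d) : (m < N)%N -> measurable B ->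
  (transition T N rho m x B)%:E = (\int[leb]_(y in B) (p m x y)%:E)%E.
Proof.
move=> mN mB; have [mp p0 p1] := rhoP mN.
rewrite /transition /Rintegral fineK// ge0_fin_numE; last first.
  by apply: integral_ge0 => y _; rewrite lee_fin.
by rewrite (le_lt_trans (integral_density_le1 x mN mB))// ltry.
Qed.

Lemma transition_ge0 m x (B : set 'rV[R]_d) : (m < N)%N ->
  0 <= transition T N rho m x B.
Proof. by move=> mN; have [_ p0 _] := rhoP mN; apply: Rintegral_ge0 => y _. Qed.

Lemma transitionT m x : (m < N)%N -> transition T N rho m x [set: 'rV[R]_d] = 1.
Proof. by move=> mN; have [_ _ p1] := rhoP mN; rewrite /transition /Rintegral p1. Qed.

Lemma measurable_transition m (B : set 'rV[R]_d) : (m < N)%N -> measurable B ->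
  measurable_fun [set: 'rV[R]_d] (fun x => transition T N rho m x B).
Proof.
move=> mN mB; have [mp p0 p1] := rhoP mN.
have mTB : measurable ([set: 'rV[R]_d] `*` B) by exact: measurableX.
pose f := (fun z : 'rV[R]_d * 'rV[R]_d => (p m z.1 z.2)%:E) \_ (setT `*` B).
have mf : measurable_fun setT f.
  apply/(measurable_restrictT (fun z : 'rV[R]_d * 'rV[R]_d => (p m z.1 z.2)%:E) mTB).
  by apply: measurable_funTS; exact/measurable_EFinP.
have f0 z : (0 <= f z)%E by rewrite /f /patch; case: ifPn => //; rewrite lee_fin.
have := measurable_fun_fubini_tonelli_F (m2 := leb) f mf f0.
rewrite (_ : fubini_F leb f = fun x => (transition T N rho m x B)%:E).
  by move/measurable_EFinP.
apply/funext => x; rewrite transitionE// [RHS]integral_mkcond.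
apply: eq_integral => y _; rewrite /f /patch in_setX/=.
by rewrite in_setT.
Qed.

End transition_kernel.

(** * Conditioning on everything except one simulation *)

Section freezing.
Context {R : realType} {d : nat} {d0 : measure_display}
  {Omega : measurableType d0}.
Variable P : probability Omega R.
Variables (T : R) (N M mY : nat).
Variable rho : 'rV[R]_d -> R -> 'rV[R]_d -> R -> R.
Variables (Xs : 'I_M -> nat -> {RV P >-> 'rV[R]_d})
  (Xt : nat -> 'I_M -> 'I_mY -> {RV P >-> 'rV[R]_d}).
Hypothesis rhoP : transition_density T N rho.
Hypothesis XtP : one_step_simulations T N rho Xs Xt.

Local Notation leb := (lebesgue_rV d).
Local Notation rV := 'rV[R]_d.
Local Notation index := ('I_N * 'I_M * 'I_mY)%type.
Local Notation smp := (M.-tuple (N.+1.-tuple rV)).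

Let Y (i : index) : {RV P >-> rV} := Xt i.1.1 i.1.2 i.2.

Let prod_index (F : index -> R) :
  \prod_(m < N) \prod_(s < M) \prod_(h < mY) F (m, s, h) = \prod_i F i.
Proof.
rewrite pair_bigA/= (eq_bigr (fun i : 'I_N * 'I_M => \prod_(h < mY) F (i, h)));
  last by case.
by rewrite pair_bigA; apply: eq_bigr => -[].
Qed.

Lemma tnth_sample (w : Omega) (s : 'I_M) (m : 'I_N.+1) :
  tnth (tnth (sample N Xs w) s) m = Xs s m w.
Proof. by rewrite !tnth_mktuple. Qed.

Lemma measurable_sample : measurable_fun [set: Omega] (sample N Xs).
Proof.
apply/measurable_fun_tnthP => s; apply/measurable_fun_tnthP => m.
apply: (eq_measurable_fun (Xs s m)); last exact: measurable_funP.
by move=> w _; rewrite /= tnth_sample.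
Qed.

Let sample_mixin := isMeasurableFun.Build _ _ _ _ _ measurable_sample.
Let sampleRV : {mfun Omega >-> smp} := HB.pack (sample N Xs) sample_mixin.

Lemma measurable_forall_simulations (B : index -> set rV) :
  (forall i, measurable (B i)) -> measurable [set w | forall i, B i (Y i w)].
Proof.
move=> mB; have -> : [set w | forall i, B i (Y i w)] =
    \bigcap_(i in [set: index]) (Y i @^-1` B i).
  by apply/seteqP; split => [w wB i _|w wB i]; exact: wB.
apply: fin_bigcap_measurable; first exact: finite_finset.
by move=> i _; rewrite -[X in measurable X]setTI; exact: measurable_funP.
Qed.

Lemma simulationsE (E : set smp) (B : index -> set rV) :
  measurable E -> (forall i, measurable (B i)) ->
  (P (sample N Xs @^-1` E `&` [set w | forall i, B i (Y i w)]) =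
   \int[P]_(w in sample N Xs @^-1` E)
     (\prod_(i : index) transition T N rho i.1.1 (Xs i.1.2 i.1.1 w) (B i))%:E)%E.
Proof.
move=> mE mB; have := XtP mE (fun m s h => mB (m, s, h)).
rewrite (_ : [set w | forall (m : 'I_N) s h, B (m, s, h) (Xt m s h w)] =
    [set w | forall i, B i (Y i w)]).
  move=> ->; apply: eq_integral => w _; congr EFin.
  exact: (prod_index (fun i => transition T N rho i.1.1 (Xs i.1.2 i.1.1 w) (B i))).
apply/seteqP; split => [w wB [[m s] h]|w wB m s h]; first exact: wB.
exact: (wB (m, s, h)).
Qed.

Variable i0 : index.

(* The pi-system of the events that do not look at the simulation i0. *)
Definition frozen_events : set (set Omega) :=
  [set A | exists E (B : index -> set rV),
    [/\ measurable E, forall i, measurable (B i), B i0 = setT &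
        A = sample N Xs @^-1` E `&` [set w | forall i, B i (Y i w)]]].

Local Notation frozen := (g_sigma_algebraType frozen_events).

Lemma frozen_events_setI : setI_closed frozen_events.
Proof.
move=> _ _ [E [B [mE mB B0 ->]]] [E' [B' [mE' mB' B0' ->]]].
exists (E `&` E'), (fun i => B i `&` B' i); split.
- exact: measurableI.
- by move=> i; exact: measurableI.
- by rewrite B0 B0' setTI.
- rewrite preimage_setI setIACA; congr (_ `&` _).
  apply/seteqP; split => w /= => [[h1 h2] i|h]; first by split.
  by split=> i; case: (h i).
Qed.

Lemma frozen_eventsT : frozen_events [set: Omega].
Proof.
exists setT, (fun=> setT); split => //.
by rewrite preimage_setT setTI; apply/seteqP.
Qed.

Lemma measurable_frozen_id :
  measurable_fun [set: Omega] (fun w => w : frozen).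
Proof.
apply: (@measurability _ _ Omega frozen setT _ frozen_events erefl).
move=> _ [_ [E [B [mE mB _ ->]]] <-].
rewrite setTI; apply: measurableI; last exact: measurable_forall_simulations.
by rewrite -[X in measurable X]setTI; exact: measurable_sample.
Qed.

Lemma measurable_frozen_sample : measurable_fun [set: frozen] (sample N Xs).
Proof.
move=> _ E mE; rewrite setTI; apply: sub_sigma_algebra.
exists E, (fun=> setT); split => //.
by rewrite -[LHS]setIT; congr (_ `&` _); apply/seteqP.
Qed.

Lemma measurable_frozen_Xs s m : (m <= N)%N ->
  measurable_fun [set: frozen] (Xs s m).
Proof.
move=> mN; have mN1 : (m < N.+1)%N by [].
have : measurable_fun [set: frozen] ((fun t : N.+1.-tuple rV => tnth t (Ordinal mN1))
    \o (fun t : smp => tnth t s) \o (sample N Xs : frozen -> smp)).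
  apply: measurableT_comp; last exact: measurable_frozen_sample.
  by apply: measurableT_comp; exact: measurable_tnth.
by apply: eq_measurable_fun => w _; rewrite /= tnth_sample.
Qed.

Lemma measurable_frozen_simulation i : i != i0 ->
  measurable_fun [set: frozen] (Y i).
Proof.
move=> ii0 _ B mB; rewrite setTI; apply: sub_sigma_algebra.
exists setT, (fun j => if j == i then B else setT); split => //.
- by move=> j; case: ifP.
- by rewrite eq_sym (negbTE ii0).
- rewrite preimage_setT setTI; apply/seteqP; split => w /= h.
    by move=> j; case: eqP => // ->.
  by have := h i; rewrite eqxx.
Qed.

Let tr (i : index) (B : set rV) (t : smp) : R :=
  transition T N rho i.1.1 (tnth (tnth t i.1.2) (widen_ord (leqnSn N) i.1.1)) B.

Let measurable_tr i B : measurable B -> measurable_fun [set: smp] (tr i B).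
Proof.
move=> mB; apply: (measurableT_comp (measurable_transition rhoP _ mB)) => //.
exact: (measurableT_comp (measurable_tnth (widen_ord (leqnSn N) i.1.1))
  (measurable_tnth i.1.2)).
Qed.

Let tr_ge0 i B t : 0 <= tr i B t.
Proof. exact: transition_ge0. Qed.

Let trE i B w : tr i B (sample N Xs w) = transition T N rho i.1.1 (Xs i.1.2 i.1.1 w) B.
Proof. by rewrite /tr tnth_sample. Qed.

(* Integrating out the other simulations, which have a conditional law given
   the sample, turns a frozen event into the product of their transitions. *)
Lemma integral_transition_frozen (E : set smp) (B : index -> set rV) (B0 : set rV) :
  measurable E -> (forall i, measurable (B i)) -> B i0 = setT -> measurable B0 ->
  (\int[P]_(w in sample N Xs @^-1` E `&` [set w | forall i, B i (Y i w)])
      (tr i0 B0 (sample N Xs w))%:E =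
   \int[P]_(w in sample N Xs @^-1` E)
      (tr i0 B0 (sample N Xs w) * \prod_i tr i (B i) (sample N Xs w))%:E)%E.
Proof.
move=> mE mB Bi0 mB0; set D := [set w | _].
have mD : measurable D by exact: measurable_forall_simulations.
pose nu := pushforward (mrestr P mD) sampleRV.
pose mu := distribution P sampleRV.
pose pr t := \prod_i tr i (B i) t.
have pr0 t : 0 <= pr t by apply: prodr_ge0 => i _; exact: tr_ge0.
have mpr : measurable_fun [set: smp] pr.
  by apply: measurable_prod => i _; exact: measurable_tr.
(* [nu] is the law of the sample restricted to the event D; by the conditional law of the
   simulations, it has density [pr] relative to the law of the sample. *)
have nuE A : measurable A -> (nu A = \int[mu]_(t in A) (pr t)%:E)%E.
  move=> mA; rewrite /nu /pushforward /mrestr simulationsE//.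
  rewrite [RHS](ge0_integral_pushforward measurable_sample)//; last 2 first.
  - by apply: measurable_funTS; exact/measurable_EFinP.
  - by move=> t _; rewrite lee_fin.
  by apply: eq_integral => w _; congr EFin; apply: eq_bigr => i _; rewrite trE.
pose phi := ((fun t => (tr i0 B0 t)%:E) \_ E)%E.
have mphi : measurable_fun [set: smp] phi.
  apply/(measurable_restrictT (fun t => (tr i0 B0 t)%:E) mE).
  by apply: measurable_funTS; apply/measurable_EFinP; exact: measurable_tr.
have phi0 t : (0 <= phi t)%E.
  by rewrite /phi /patch; case: ifPn => //; rewrite lee_fin.
have mind : measurable_fun [set: Omega] (\1_D : Omega -> R) by exact: measurable_indic.
transitivity (\int[nu]_t phi t)%E.
  rewrite (ge0_integral_pushforward measurable_sample)//.
  rewrite preimage_setT (@integral_density _ _ _ P _ \1_D)//; last 3 first.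
  - by move=> A mA; rewrite /= /mrestr integral_indic// setIC.
  - exact: measurableT_comp mphi measurable_sample.
  - by move=> w; exact: phi0.
  rewrite [LHS]integral_mkcond; apply: eq_integral => w _.
  rewrite /= /phi /patch indicE in_setI; case: (boolP (w \in D)) => wD.
    by rewrite andbT mule1.
  by rewrite andbF mule0.
rewrite (@integral_density _ _ _ mu _ pr)// ge0_integral_distribution//; last 2 first.
- by apply: emeasurable_funM => //; exact/measurable_EFinP.
- by move=> t; rewrite mule_ge0// lee_fin.
rewrite [RHS]integral_mkcond; apply: eq_integral => w _.
rewrite /= /phi /patch; case: ifPn => wE; case: ifPn => // wE'.
- by move: wE'; rewrite notin_setE; move: wE; rewrite inE.
- by move: wE; rewrite notin_setE; move: wE'; rewrite inE.
- by rewrite mul0e.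
Qed.

Let frozen_mixin := isMeasurableFun.Build _ _ _ _ _ measurable_frozen_id.
Let frozenRV : {mfun Omega >-> frozen} :=
  HB.pack (fun w : Omega => w : frozen) frozen_mixin.

Lemma integral_frozen (f : frozen * rV -> \bar R) :
  measurable_fun [set: frozen * rV] f -> (forall z, (0 <= f z)%E) ->
  (\int[P]_w f (w, Y i0 w) = \int[P]_w \int[leb]_y (f (w, y) *
     (rho (Xs i0.1.2 i0.1.1 w) (grid T N i0.1.1) y (grid T N i0.1.1.+1))%:E))%E.
Proof.
have n0N : (i0.1.1 < N)%N by [].
have [mp p0 p1] := rhoP n0N.
apply: (@integral_conditional_density _ _ _ Omega frozen rV R P leb
  frozenRV (Y i0) (fun z : frozen * rV => rho (Xs i0.1.2 i0.1.1 z.1)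
    (grid T N i0.1.1) z.2 (grid T N i0.1.1.+1)) frozen_events).
- apply: (measurableT_comp mp (g := fun z : frozen * rV =>
    (Xs i0.1.2 i0.1.1 z.1, z.2))).
  apply: measurable_fun_pair => //.
  apply: measurableT_comp; last exact: measurable_fst.
  by apply: measurable_frozen_Xs; exact: ltnW.
- by move=> z; exact: p0.
- by [].
- exact: frozen_events_setI.
- exact: frozen_eventsT.
move=> _ B0 [E [B [mE mB Bi0 ->]]] mB0.
pose B' i := if i == i0 then B0 else B i.
have mB' i : measurable (B' i) by rewrite /B'; case: ifP.
have -> : frozenRV @^-1` (sample N Xs @^-1` E `&`
    [set w | forall i, B i (Y i w)]) `&` Y i0 @^-1` B0 =
    sample N Xs @^-1` E `&` [set w | forall i, B' i (Y i w)].
  rewrite -setIA; congr (_ `&` _); apply/seteqP; split => w /=.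
    by move=> [h1 h2] i; rewrite /B'; case: eqP => // ->.
  move=> h; split => [i|]; last by have := h i0; rewrite /B' eqxx.
  by have := h i; rewrite /B'; case: eqP => // ->; rewrite Bi0.
rewrite simulationsE//.
(* [B i0] is the whole space, so its factor in the product over [B] is 1, and replacing it by [B0]
   multiplies that product by the transition to [B0]. *)
transitivity (\int[P]_(w in sample N Xs @^-1` E)
    (tr i0 B0 (sample N Xs w) * \prod_i tr i (B i) (sample N Xs w))%:E)%E.
  apply: eq_integral => w _; congr EFin.
  rewrite (bigD1 i0)//= [in RHS](bigD1 i0)//= !trE Bi0 transitionT// mul1r.
  rewrite {1}/B' eqxx; congr (_ * _); apply: eq_bigr => i ii0.
  by rewrite trE /B' (negbTE ii0).
rewrite -integral_transition_frozen//; apply: eq_integral => w _.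
by rewrite trE transitionE.
Qed.

End freezing.

(** * Centred values of the simulations *)

Lemma measurable_superlevel d (T : measurableType d) (R : realType) (h : T -> R)
    (a : R) : measurable_fun [set: T] h -> measurable [set t | a <= h t].
Proof.
move=> mh; rewrite -[X in measurable X]setTI.
rewrite (_ : [set t | _] = h @^-1` `[a, +oo[%classic); first by apply: mh.
by apply/seteqP; split => t /=; rewrite in_itv/= andbT.
Qed.

Section deviations.
Context {R : realType} {d : nat}.
Variables (L l1 r : R).
Hypotheses (L0 : 0 < L) (l10 : 0 < l1).
Variable p : 'rV[R]_d -> 'rV[R]_d -> R.
Hypotheses (mp2 : measurable_fun [set: 'rV[R]_d * 'rV[R]_d] (fun z => p z.1 z.2))
  (p0 : forall x y, 0 <= p x y)
  (p_le : forall x y, `|p x y| <= l1^-1 * expR (- (l1 * enorm (x - y) ^+ 2))).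

Local Notation leb := (lebesgue_rV d).
Local Notation rV := 'rV[R]_d.

Lemma measurable_density_section x : measurable_fun [set: rV] (p x).
Proof. exact: (measurableT_comp mp2 (pair1_measurable x)). Qed.

Lemma measurable_Rintegral_section d1 (S : measurableType d1) (F : S * rV -> R) :
  measurable_fun [set: S * rV] F -> (forall z, 0 <= F z) ->
  measurable_fun [set: S] (fun t => \int[leb]_y F (t, y)).
Proof.
move=> mF F0; apply: (measurableT_comp (fine_measurable measurableT)).
apply: (measurable_fun_fubini_tonelli_F (EFin \o F)).
  exact/measurable_EFinP.
by move=> z; rewrite lee_fin.
Qed.

(** Set to 0 off the ball of radius r because the exponential moment bound is uniform only there;
    for neighbours of points of Q the cut-off will be inactive. *)
Definition deviation {S : Type} (G : S -> rV -> R) (x : S -> rV) (y : S -> rV)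
    (t : S) : R :=
  if enorm (x t) <= r then G t (y t) - \int[leb]_z (G t z * p (x t) z) else 0.

Lemma measurable_deviation d1 (S : measurableType d1) (G : S -> rV -> R)
    (x y : S -> rV) :
  measurable_fun [set: S * rV] (fun z : S * rV => G z.1 z.2) ->
  (forall t z, `|G t z| <= growth L z) ->
  measurable_fun [set: S] x -> measurable_fun [set: S] y ->
  measurable_fun [set: S] (deviation G x y).
Proof.
move=> mG Gle mx my.
have mpx : measurable_fun [set: S * rV] (fun z : S * rV => p (x z.1) z.2).
  apply: (measurableT_comp mp2 (g := fun z : S * rV => (x z.1, z.2))).
  by apply: measurable_fun_pair => //; exact: (measurableT_comp mx).
have mgr : measurable_fun [set: S * rV] (fun z : S * rV => growth L z.2).
  exact: (measurableT_comp (measurable_growth L) measurable_snd).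
have mGy : measurable_fun [set: S] (fun t => G t (y t)).
  apply: (measurableT_comp mG (g := fun t => (t, y t))).
  exact: measurable_fun_pair.
have gr0 (z : rV) : 0 <= growth L z by exact: growth_ge0.
(* Measurability of a parametrised integral is available for nonnegative integrands: adding the
   growth makes [F1] nonnegative, and [F2] takes it away again. *)
pose F1 (z : S * rV) := (G z.1 z.2 + growth L z.2) * p (x z.1) z.2.
pose F2 (z : S * rV) := growth L z.2 * p (x z.1) z.2.
have mF1 : measurable_fun [set: S] (fun t => \int[leb]_y F1 (t, y)).
  apply: measurable_Rintegral_section.
    by apply: measurable_funM => //; exact: measurable_funD.
  move=> z; rewrite mulr_ge0// -lerBlDr sub0r.
  by have := Gle z.1 z.2; rewrite ler_norml => /andP[].
have mF2 : measurable_fun [set: S] (fun t => \int[leb]_y F2 (t, y)).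
  apply: measurable_Rintegral_section; first exact: measurable_funM.
  by move=> z; rewrite mulr_ge0.
apply: (@eq_measurable_fun _ _ _ _ _ (fun t => if enorm (x t) <= r then
  G t (y t) - (\int[leb]_y F1 (t, y) - \int[leb]_y F2 (t, y)) else 0)).
  move=> t _; rewrite /deviation; case: ifPn => // xr; congr (_ - _).
  have mGt : measurable_fun [set: rV] (G t).
    exact: (measurableT_comp mG (pair1_measurable t)).
  have iG := integrable_Wp l10 measurable_density_section p0 p_le mGt (Gle t) xr.
  have gn (z : rV) : `|growth L z| <= growth L z by rewrite ger0_norm.
  have iL := integrable_Wp l10 measurable_density_section p0 p_le
    (measurable_growth L) gn xr.
  have iGL := integrableD measurableT iG iL.
  have -> : (fun y => F1 (t, y)) =
      (fun y => G t y * p (x t) y + growth L y * p (x t) y).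
    by apply/funext => z; rewrite /F1 mulrDl.
  by rewrite RintegralD// addrK.
apply: measurable_fun_ifT => //.
- by apply: measurable_fun_ler => //; exact: (measurableT_comp measurable_enorm).
- by apply: measurable_funB => //; exact: measurable_funB.
Qed.

End deviations.

(** * Chernoff bounds for sums of deviations *)

Section concentration.
Context {R : realType} {d : nat} {d0 : measure_display}
  {Omega : measurableType d0}.
Variable P : probability Omega R.
Variables (T : R) (N M mY : nat).
Variable rho : 'rV[R]_d -> R -> 'rV[R]_d -> R -> R.
Variables (Xs : 'I_M -> nat -> {RV P >-> 'rV[R]_d})
  (Xt : nat -> 'I_M -> 'I_mY -> {RV P >-> 'rV[R]_d}).
Hypothesis rhoP : transition_density T N rho.
Hypothesis XtP : one_step_simulations T N rho Xs Xt.
Variables (L l1 r : R).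
Hypotheses (L0 : 0 < L) (l10 : 0 < l1).
Variable n : 'I_N.

Local Notation leb := (lebesgue_rV d).
Local Notation rV := 'rV[R]_d.
Local Notation p := (fun x y => rho x (grid T N n) y (grid T N n.+1)).
Local Notation index := ('I_M * 'I_mY)%type.
Local Notation frozen i :=
  (g_sigma_algebraType (frozen_events Xs Xt (n, i.1, i.2))).

Hypothesis p_le : forall x y,
  `|p x y| <= l1^-1 * expR (- (l1 * enorm (x - y) ^+ 2)).

Variable G : Omega -> rV -> R.
Hypothesis mG : forall i : index,
  measurable_fun [set: frozen i * rV] (fun z : frozen i * rV => G z.1 z.2).
Hypothesis G_le : forall w y, `|G w y| <= growth L y.

Definition sim_deviation (i : index) : Omega -> R :=
  deviation r p G (Xs i.1 n) (Xt n i.1 i.2).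

Let mp2 : measurable_fun [set: rV * rV] (fun z => p z.1 z.2).
Proof. by have [] := rhoP (ltn_ord n). Qed.

Let p0 x y : 0 <= p x y.
Proof. by have [] := rhoP (ltn_ord n). Qed.

Let p1 x : (\int[leb]_y (p x y)%:E = 1)%E.
Proof. by have [] := rhoP (ltn_ord n). Qed.

Lemma measurable_frozen_deviation i j : i != j ->
  measurable_fun [set: frozen i] (sim_deviation j).
Proof.
move=> ij; apply: (@measurable_deviation _ _ _ _ _ L0 l10 _ mp2 p0 p_le _
  (frozen i) G (Xs j.1 n) (Xt n j.1 j.2)).
- exact: (@mG i).
- exact: G_le.
- by apply: measurable_frozen_Xs; exact: ltnW.
- apply: (measurable_frozen_simulation (i := (n, j.1, j.2))).
  apply: contra ij => /eqP[e1 e2]; rewrite eq_sym.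
  by case: i j e1 e2 => [a b] [a' b'] /= -> ->.
Qed.

Lemma measurable_sim_deviation i : measurable_fun [set: Omega] (sim_deviation i).
Proof.
apply: (@measurable_deviation _ _ _ _ _ L0 l10 _ mp2 p0 p_le _
  Omega G (Xs i.1 n) (Xt n i.1 i.2)) => //.
apply: (measurableT_comp (@mG i) (g := fun z : Omega * rV => (z.1 : frozen i, z.2))).
apply: measurable_fun_pair => //.
have mid : measurable_fun [set: Omega] (fun w => w : frozen i).
  exact: measurable_frozen_id.
exact: (measurableT_comp mid measurable_fst).
Qed.

Let measurable_dev_sum (l : seq index) th :
  measurable_fun [set: Omega] (fun w => expR (th * \sum_(i <- l) sim_deviation i w)).
Proof.
apply: measurableT_comp => //; apply: measurable_funM => //.
by apply: measurable_sum => i; exact: measurable_sim_deviation.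
Qed.

Let measurable_frozen_deviation_sum i (l : seq index) : i \notin l ->
  measurable_fun [set: frozen i] (fun w => \sum_(j <- l) sim_deviation j w).
Proof.
elim: l => [_|j l IHl].
  by under eq_fun do rewrite big_nil; exact: measurable_cst.
rewrite inE negb_or => /andP[ij il]; under eq_fun do rewrite big_cons.
by apply: measurable_funD; [exact: measurable_frozen_deviation|exact: IHl].
Qed.

(** Induction on the list. As i does not occur in l, the sum over l is measurable for the
    sigma-algebra that ignores simulation i; this simulation is then integrated against its density
    and contributes one factor exp([mgf_bound] th^2). *)
Lemma mgf_deviation_sum (l : seq index) (th : R) : uniq l -> `|th| <= 1 ->
  (\int[P]_w (expR (th * \sum_(i <- l) sim_deviation i w))%:E <=
   (expR (@mgf_bound R d L l1 r * th ^+ 2 * (size l)%:R))%:E)%E.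
Proof.
move=> + th1; elim: l => [_|i l IHl /andP[il ul]].
  under eq_integral do rewrite big_nil mulr0 expR0.
  rewrite mulr0 expR0 integral_cst// mul1e; exact: probability_le1.
pose F w := expR (th * \sum_(j <- l) sim_deviation j w).
pose X w := Xs i.1 n w.
pose V (w : frozen i) y := th * (if enorm (X w) <= r
   then G w y - \int[leb]_z (G w z * p (X w) z) else 0).
pose f (z : frozen i * rV) := (F z.1 * expR (V z.1 z.2))%:E.
have mF : measurable_fun [set: frozen i] (F : frozen i -> R).
  apply: measurableT_comp => //; apply: measurable_funM => //.
  exact: measurable_frozen_deviation_sum.
have mf : measurable_fun [set: frozen i * rV] f.
  apply/measurable_EFinP; apply: measurable_funM.
    exact: (measurableT_comp mF measurable_fst).
  apply: measurableT_comp => //; apply: measurable_funM => //.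
  (* The simulated point is a free variable here: the parameter space is the product, and the point
     is its second coordinate. *)
  apply: (@measurable_deviation _ _ _ _ _ L0 l10 _ mp2 p0 p_le _
    (frozen i * rV)%type (fun z => G z.1) (fun z => X z.1) snd).
  - apply: (measurableT_comp (@mG i)
      (g := fun z : frozen i * rV * rV => (z.1.1, z.2))).
    apply: measurable_fun_pair => //.
    exact: (measurableT_comp measurable_fst measurable_fst).
  - by move=> z y; exact: G_le.
  - apply: (measurableT_comp _ measurable_fst).
    by apply: measurable_frozen_Xs; exact: ltnW.
  - exact: measurable_snd.
have f0 z : (0 <= f z)%E by rewrite lee_fin mulr_ge0 ?expR_ge0.
have -> : (\int[P]_w (expR (th * \sum_(j <- i :: l) sim_deviation j w))%:E =
   \int[P]_w f (w, Xt n i.1 i.2 w))%E.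
  apply: eq_integral => w _; congr EFin.
  by rewrite big_cons mulrDr expRD mulrC.
rewrite (integral_frozen rhoP XtP mf f0)/=.
have e0 w y : 0 <= expR (V w y) * p (X w) y by rewrite mulr_ge0 ?expR_ge0.
have me w : measurable_fun [set: rV] (fun y => (expR (V w y) * p (X w) y)%:E).
  apply/measurable_EFinP; apply: measurable_funM.
    apply: measurableT_comp => //; apply: measurable_funM => //.
    case: (enorm (X w) <= r) => //; apply: measurable_funB => //.
    exact: (measurableT_comp (@mG i) (pair1_measurable (w : frozen i))).
  exact: (measurable_density_section mp2 (X w)).
have step w : (\int[leb]_y (f (w, y) * (p (X w) y)%:E) <=
    (F w)%:E * (expR (@mgf_bound R d L l1 r * th ^+ 2))%:E)%E.
  under eq_integral do rewrite /f /= -EFinM -mulrA EFinM.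
  rewrite ge0_integralZl//; last 2 first.
  - by move=> y _; rewrite lee_fin.
  - by rewrite lee_fin expR_ge0.
  rewrite lee_wpmul2l ?lee_fin ?expR_ge0//; rewrite /V.
  case: (boolP (enorm (X w) <= r)) => xr.
    apply: (mgf_le l10 (measurable_density_section mp2) p0 p1 p_le _ (@G_le w) xr th1).
    exact: (measurableT_comp (@mG i) (pair1_measurable (w : frozen i))).
  (* Off the ball the deviation is 0 and contributes the factor 1, below the bound since [mgf_bound]
     is nonnegative. *)
  under eq_integral do rewrite mulr0 expR0 mul1r.
  rewrite p1 lee_fin -[leLHS]expR0 ler_expR mulr_ge0 ?sqr_ge0//.
  exact: mgf_bound_ge0.
have mFO : measurable_fun [set: Omega] (fun w => (F w)%:E).
  by apply/measurable_EFinP; exact: measurable_dev_sum.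
apply: (@le_trans _ _ (\int[P]_w
    ((F w)%:E * (expR (@mgf_bound R d L l1 r * th ^+ 2))%:E)))%E.
  apply: ge0_le_integral => //.
  - by move=> w _; apply: integral_ge0 => y _; rewrite mule_ge0// lee_fin.
  - have mfp : measurable_fun [set: frozen i * rV]
        (fun z : frozen i * rV => f z * (p (X z.1) z.2)%:E)%E.
      apply: emeasurable_funM => //; apply/measurable_EFinP.
      apply: (measurableT_comp mp2 (g := fun z : frozen i * rV => (X z.1, z.2))).
      apply: measurable_fun_pair => //; apply: (measurableT_comp _ measurable_fst).
      by apply: measurable_frozen_Xs; exact: ltnW.
    have := measurable_fun_fubini_tonelli_F (m2 := leb) _ mfp.
    have fp0 z : (0 <= f z * (p (X z.1) z.2)%:E)%E by rewrite mule_ge0// lee_fin.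
    move=> /(_ fp0) mFF.
    have mid : measurable_fun [set: Omega] (fun w => w : frozen i).
      exact: measurable_frozen_id.
    by move: (measurableT_comp mFF mid); apply: eq_measurable_fun => w _.
  - by apply: emeasurable_funM.
  - by move=> w _; exact: step.
have F0 w : [set: Omega] w -> (0 <= (F w)%:E)%E by rewrite lee_fin expR_ge0.
rewrite ge0_integralZr ?lee_fin ?expR_ge0//.
apply: (le_trans (lee_wpmul2r _ (IHl ul))); first by rewrite lee_fin expR_ge0.
by rewrite -EFinM -expRD /= -natr1 mulrDr mulr1.
Qed.

(** Markov's inequality for the exponential; th may be negative, so the same bound serves both
    tails. *)
Let chernoff_deviation (l : seq index) (th a : R) : uniq l -> `|th| <= 1 ->
  (P [set w | (a <= th * \sum_(i <- l) sim_deviation i w)%R] <=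
   (expR (@mgf_bound R d L l1 r * th ^+ 2 * (size l)%:R - a))%:E)%E.
Proof.
move=> ul th1; pose F w := th * \sum_(i <- l) sim_deviation i w.
have mF : measurable_fun [set: Omega] F.
  apply: measurable_funM => //.
  by apply: measurable_sum => i; exact: measurable_sim_deviation.
have mA : measurable [set w | (a <= F w)%R] by exact: measurable_superlevel.
rewrite expRD EFinM expRN.
have ea : (0 < (expR a)%:E)%E by rewrite lte_fin expR_gt0.
rewrite -[leLHS](_ : (expR a)^-1%:E * ((expR a)%:E * P [set w | (a <= F w)%R]) = _)%E.
  rewrite muleC lee_wpmul2r ?lee_fin ?invr_ge0 ?expR_ge0//.
  apply: le_trans (mgf_deviation_sum ul th1).
  set A := [set w | _].
  have mI : measurable_fun [set: Omega] (fun w => (\1_A w)%:E : \bar R).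
    by apply/measurable_EFinP; exact: measurable_indic.
  have -> : ((expR a)%:E * P A = \int[P]_w ((expR a)%:E * (\1_A w)%:E))%E.
    by rewrite ge0_integralZl ?integral_indic ?setIT ?lee_fin ?expR_ge0.
  apply: ge0_le_integral; first exact: measurableT.
  - by move=> w _; rewrite -EFinM lee_fin mulr_ge0 ?expR_ge0// indicE.
  - by apply: emeasurable_funM.
  - by apply/measurable_EFinP; exact: measurable_dev_sum.
  - move=> w _; rewrite indicE -EFinM lee_fin.
    case: (boolP (w \in A)) => wA; last by rewrite mulr0 expR_ge0.
    by rewrite mulr1 ler_expR; move: wA; rewrite inE.
by rewrite muleA -EFinM mulVf ?mul1e// gt_eqF// expR_gt0.
Qed.

(* The Chernoff bound, optimised at th = e / (2 v). *)
Lemma deviation_tail (l : seq index) (v e : R) : uniq l ->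
  @mgf_bound R d L l1 r <= v -> 0 < v -> 0 < e -> e <= 2 * v ->
  (P [set w | ((size l)%:R * e <= `|\sum_(i <- l) sim_deviation i w|)%R] <=
   (2 * expR (- ((size l)%:R * e ^+ 2 / (4 * v))))%:E)%E.
Proof.
move=> ul bv v0 e0 ev; pose S w := \sum_(i <- l) sim_deviation i w.
pose th := e / (2 * v); have th0 : 0 < th by rewrite divr_gt0// mulr_gt0.
have th1 : `|th| <= 1 by rewrite gtr0_norm// ler_pdivrMr ?mulr_gt0// mul1r.
have thN1 : `|- th| <= 1 by rewrite normrN.
pose a := th * ((size l)%:R * e).
have bnd : expR (@mgf_bound R d L l1 r * th ^+ 2 * (size l)%:R - a) <=
    expR (- ((size l)%:R * e ^+ 2 / (4 * v))).
  rewrite ler_expR; apply: (@le_trans _ _ (v * th ^+ 2 * (size l)%:R - a)).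
    by rewrite lerD2r !ler_wpM2r ?sqr_ge0.
  rewrite le_eqVlt; apply/orP; left; apply/eqP.
  by rewrite /a /th; field; rewrite gt_eqF.
have mS : measurable_fun [set: Omega] S.
  by apply: measurable_sum => i; exact: measurable_sim_deviation.
have mthS t : measurable_fun [set: Omega] (fun w => t * S w) by exact: measurable_funM.
apply: (@le_trans _ _ (P ([set w | (a <= th * S w)%R] `|`
    [set w | (a <= (- th) * S w)%R]))).
  apply: le_measure; rewrite ?inE.
  - by apply: measurable_superlevel; exact: measurableT_comp.
  - by apply: measurableU; apply: measurable_superlevel; exact: mthS.
  - move=> w /=; rewrite /a mulNr -mulrN !ler_pM2l//.
    by rewrite ler_normr => /orP[|] h; [left|right].
apply: le_trans (measureU2 _ _ _) _; [by apply: measurable_superlevel; exact: mthS..|].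
rewrite mulrDl mul1r EFinD; apply: leeD.
- by apply: le_trans (chernoff_deviation a ul th1) _; rewrite lee_fin.
- apply: le_trans (chernoff_deviation a ul thN1) _.
  by rewrite sqrrN lee_fin.
Qed.

End concentration.

(** * Nearest neighbours as the indices of smallest rank *)

Section nearest_neighbours.
Context {R : realType} {d M : nat}.
Variables (k : nat) (xs : 'I_M -> nat -> 'rV[R]_d) (m : nat) (x : 'rV[R]_d).

Local Notation dist s := (enorm (xs s m - x)).
Local Notation closer := (closer xs m x).

Lemma closer_irr s : ~~ closer s s.
Proof. by rewrite /closer ltxx ltnn andbF. Qed.

Lemma closer_trans r s t : closer r s -> closer s t -> closer r t.
Proof.
rewrite /closer => /orP[rs|/andP[/eqP rs rs']] /orP[st|/andP[/eqP st st']].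
- by rewrite (lt_trans rs st).
- by rewrite -st rs.
- by rewrite rs st.
- by rewrite rs st eqxx (ltn_trans rs' st') orbT.
Qed.

Lemma closer_total r s : r != s -> closer r s || closer s r.
Proof.
move=> rs; rewrite /closer; have [//|//|e] := ltgtP (dist r) (dist s).
by rewrite /= -neq_ltn.
Qed.

Let rank (s : 'I_M) : nat := #|[pred r | closer r s]|.

Let rank_lt s : (rank s < M)%N.
Proof.
rewrite -[X in (_ < X)%N](card_ord M); apply: proper_card.
apply/properP; split; first exact/fintype.subsetP.
by exists s => //; rewrite inE; exact: closer_irr.
Qed.

Let closer_rank r s : closer r s -> (rank r < rank s)%N.
Proof.
move=> rs; apply: proper_card; apply/properP; split.
  by apply/fintype.subsetP => t; rewrite !inE => tr; exact: closer_trans rs.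
by exists r; rewrite ?inE//; exact: closer_irr.
Qed.

Let ord_rank s : 'I_M := Ordinal (rank_lt s).

Let ord_rank_inj : injective ord_rank.
Proof.
move=> r s /(congr1 val) /= rs; apply/eqP; apply: contraT => /closer_total.
by move=> /orP[] /closer_rank; rewrite rs ltnn.
Qed.

(** Breaking ties by index makes [closer] a strict total order. Its rank function is therefore
    injective, hence a permutation of the M indices, and k of the ranks lie below k. *)
Lemma card_knn : (k <= M)%N -> #|knn k xs m x| = k.
Proof.
move=> kM; rewrite -(card_imset _ ord_rank_inj).
have -> : ord_rank @: knn k xs m x = [set i : 'I_M | (i < k)%N]%SET.
  apply/setP => i; rewrite inE; apply/imsetP/idP => [[s + ->]|ik].
    by rewrite inE.
  have [g _ gK] := injF_bij ord_rank_inj.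
  by exists (g i); rewrite ?gK// inE -[#|_|]/(val (ord_rank (g i))) gK.
rewrite -sum1_card (eq_bigl (fun i : 'I_M => (i < k)%N)).
  by rewrite -(big_ord_widen M (fun=> 1%N) kM) sum1_card card_ord.
by move=> i; rewrite inE.
Qed.

(** If s were at distance at least r, all the points within r would be closer to x, and the rank of
    s would be at least k. *)
Lemma knn_dist_lt (r : R) s :
  (k <= #|[set t | (dist t < r)%R]%SET|)%N -> s \in knn k xs m x -> dist s < r.
Proof.
move=> kr; rewrite inE; apply: contraLR; rewrite -leNgt -leqNgt => rs.
apply: leq_trans kr _; apply: subset_leq_card; apply/fintype.subsetP => t.
by rewrite !inE /closer => tr; rewrite (lt_le_trans tr rs).
Qed.

End nearest_neighbours.

(** * Union bound over a list of events *)

Section union_bound.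
Context {d0 : measure_display} {Omega : measurableType d0} {R : realType}.
Variable P : {measure set Omega -> \bar R}.

Lemma measure_bigU_le (I : Type) (s : seq I) (A : I -> set Omega) :
  (forall i, measurable (A i)) ->
  (P (\big[setU/set0]_(i <- s) A i) <= \sum_(i <- s) P (A i))%E.
Proof.
move=> mA; elim: s => [|i s IHs]; first by rewrite !big_nil measure0.
rewrite !big_cons; apply: le_trans (measureU2 _ _ _) _ => //.
  exact: bigsetU_measurable.
exact: leeD.
Qed.

End union_bound.

(** * Covering a bounded set by small balls centred in it *)

Section covering.
Context {R : realType} {d : nat}.
Hypothesis d0 : (0 < d)%N.
Variables (Q : set 'rV[R]_d) (b : R).
Hypotheses (b0 : 0 < b) (Qb : forall x, Q x -> enorm x <= b) (Q0 : Q !=set0).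

(** Cubes of side r / d: two points in the same cube are at Euclidean distance at most r. The
    centres are taken in Q because [sup_pc] is a supremum over Q. *)
Lemma euclidean_cover (r : R) : 0 < r -> r <= 4^-1 ->
  exists (I : finType) (ctr : I -> 'rV[R]_d),
  [/\ #|I|%:R <= ((2 * b * d%:R + 4^-1) / r) ^+ d, forall i, Q (ctr i) &
      forall x, Q x -> exists i, enorm (x - ctr i) <= r].
Proof.
move=> r0 r1; pose eta := r / d%:R.
have dR : 0 < d%:R :> R by rewrite ltr0n.
have eta0 : 0 < eta by rewrite divr_gt0.
pose q := (Num.truncn (2 * b / eta)).+1.
pose cell (x : 'rV[R]_d) : {ffun 'I_d -> 'I_q} :=
  [ffun i => inord (Num.truncn ((x 0 i + b) / eta))].
have [x0 Qx0] := Q0.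
(* Each cell is represented by one of its points in Q; a cell that misses Q gets the default [x0],
   which is in Q as well. *)
pose ctr a : 'rV[R]_d := xget x0 [set x | Q x /\ cell x = a].
exists {ffun 'I_d -> 'I_q}, ctr; split.
- rewrite card_ffun !card_ord natrX lerXn2r ?nnegrE//.
    apply: divr_ge0; last exact: ltW.
    by rewrite addr_ge0 ?invr_ge0// mulr_ge0// mulr_ge0// ltW.
  (* There are at most [2 * b / eta + 1] cells per axis, and r <= 1/4 bounds the 1 by (1/4) / r. *)
  rewrite /q -natr1; apply: (@le_trans _ _ (2 * b / eta + 1)).
    rewrite lerD2r truncn_le.
    by apply: divr_ge0; [rewrite mulr_ge0// ltW|exact: ltW].
  rewrite ler_pdivlMr// mulrDl mul1r.
  have -> : 2 * b / eta * r = 2 * b * d%:R.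
    by rewrite /eta; field; rewrite !gt_eqF.
  by rewrite lerD2l.
- by move=> a; rewrite /ctr; case: xgetP => [y _ []|].
move=> x Qx; exists (cell x).
have [Qy xy] : Q (ctr (cell x)) /\ cell (ctr (cell x)) = cell x.
  exact: (xgetPex x0 (ex_intro (fun y => Q y /\ cell y = cell x) x (conj Qx erefl))).
move: (ctr (cell x)) Qy xy => y Qy xy.
have -> : r = d%:R * eta by rewrite /eta mulrC divfK// gt_eqF.
apply: enorm_le_coord; first exact: ltW.
have coordP (z : 'rV[R]_d) (i : 'I_d) : Q z -> 0 <= (z 0 i + b) / eta <= 2 * b / eta.
  move=> Qz; have := le_trans (ler_coord_enorm z i) (Qb Qz).
  rewrite ler_norml => /andP[z1 z2]; apply/andP; split.
    by rewrite divr_ge0 ?(ltW eta0)//; rewrite -lerBlDr sub0r.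
  rewrite ler_pM2r ?invr_gt0//.
  have -> : 2 * b = b + b by ring.
  by rewrite lerD2r.
have truncP (z : 'rV[R]_d) (i : 'I_d) : Q z -> (Num.truncn ((z 0 i + b) / eta)%R < q)%N.
  move=> Qz; rewrite ltnS; apply: le_truncn.
  by have /andP[] := coordP z i Qz.
move=> i; rewrite !mxE.
have /ffunP/(_ i) := xy; rewrite !ffunE => /(congr1 val).
rewrite /= !inordK ?truncP// => e.
have /andP[x1 _] := coordP x i Qx; have /andP[y1 _] := coordP y i Qy.
have /andP[x2 x3] := truncn_itv x1; have /andP[y2 y3] := truncn_itv y1.
rewrite e in y2 y3; rewrite -natr1 in x3 y3.
have -> : x 0 i - y 0 i = eta * ((x 0 i + b) / eta - (y 0 i + b) / eta).
  by field; rewrite gt_eqF.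
rewrite normrM gtr0_norm// ler_piMr ?(ltW eta0)// ler_norml; lra.
Qed.

(** On Q the Gaussian is at least e^(-b^2), and its integral over the whole space is finite. *)
Lemma lebesgue_bounded_lty : measurable Q -> (lebesgue_rV d Q < +oo)%E.
Proof.
move=> mQ; have e0 : 0 < expR (- b ^+ 2) :> R by exact: expR_gt0.
have : ((expR (- b ^+ 2))%:E * lebesgue_rV d Q <=
    \int[lebesgue_rV d]_y (gauss 1 y)%:E)%E.
  rewrite -integral_cst//; apply: (@le_trans _ _
     (\int[lebesgue_rV d]_(y in Q) (gauss 1 y)%:E)%E).
    apply: ge0_le_integral => //.
    - by move=> y _; rewrite lee_fin ltW.
    - by apply: measurable_funTS; apply/measurable_EFinP; exact: measurable_gauss.
    - move=> y Qy; rewrite lee_fin ler_expR lerN2 mul1r lerXn2r ?nnegrE ?enorm_ge0//.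
        exact: ltW.
      exact: Qb.
  apply: ge0_subset_integral => //.
  - by apply/measurable_EFinP; exact: measurable_gauss.
  - by move=> y _; rewrite lee_fin gauss_ge0.
have := integral_gauss_lty d (@ltr01 R) => /[swap] h1 h2.
have := le_lt_trans h1 h2; rewrite !ltey; apply: contra => /eqP ->.
by rewrite gt0_muley ?lte_fin.
Qed.

End covering.

(** * Lower tail of the number of data points in a ball *)

Section hoeffding.
Context {R : realType}.

(** The quadratic bound on the exponential leaves 1 + th^2 q (1 - q), and q (1 - q) <= 1/4. The
    constant is cruder than Hoeffding's 1/8 but suffices for the exponent aimed at. *)
Lemma bernoulli_mgf (q th : R) : 0 <= q <= 1 -> 0 <= th <= 1 ->
  q * expR (th * (1 - q)) + (1 - q) * expR (- (th * q)) <=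
  expR (th ^+ 2 / 4).
Proof.
move=> /andP[q0 q1] /andP[t0 t1].
have h1 : `|th * (1 - q)| <= 1.
  by rewrite ger0_norm ?mulr_ge0 ?subr_ge0// mulr_ile1 ?subr_ge0// lerBlDr lerDl.
have h2 : `|- (th * q)| <= 1.
  by rewrite normrN ger0_norm ?mulr_ge0// mulr_ile1.
have q1' : 0 <= 1 - q by rewrite subr_ge0.
have e1 := ler_wpM2l q0 (expR_le_quadratic h1).
have e2 := ler_wpM2l q1' (expR_le_quadratic h2).
apply: le_trans (lerD e1 e2) _; apply: le_trans (expR_ge1Dx _).
rewrite [leLHS](_ : _ = 1 + th ^+ 2 * (q * (1 - q))); last by ring.
rewrite lerD2l ler_wpM2l ?sqr_ge0//.
have -> : q * (1 - q) = 4^-1 - (q - 2^-1) ^+ 2 by field.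
by rewrite lerBlDr lerDl sqr_ge0.
Qed.

Context {d : nat} {d0 : measure_display} {Omega : measurableType d0}.
Variable P : probability Omega R.
Variables (N M : nat) (X : nat -> {RV P >-> 'rV[R]_d})
  (Xs : 'I_M -> nat -> {RV P >-> 'rV[R]_d}).
Hypothesis XsP : independent_copies N X Xs.
Variables (n k : nat) (B : set 'rV[R]_d).
Hypotheses (nN : (n <= N)%N) (k0 : (0 < k <= M)%N) (mB : measurable B).

Let q : R := fine (P [set w | ~ B (X n w)]).

Let mRV (Y : {RV P >-> 'rV[R]_d}) A : measurable A -> measurable (Y @^-1` A).
Proof. by move=> mA; rewrite -[X in measurable X]setTI; exact: measurable_funP. Qed.

Let qE : P (X n @^-1` (~` B)) = q%:E.
Proof.
rewrite /q fineK//; apply: fin_num_measure.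
exact: (mRV (X n) (measurableC mB)).
Qed.

Let q01 : 0 <= q <= 1.
Proof.
rewrite -!lee_fin -qE measure_ge0 probability_le1//.
exact: (mRV (X n) (measurableC mB)).
Qed.

Let pB : P (X n @^-1` B) = (1 - q)%:E.
Proof.
rewrite EFinB -qE -[X n @^-1` B]setCK probability_setC; last first.
  exact: (measurableC (mRV (X n) mB)).
by rewrite preimage_setC.
Qed.

Let S (b : bool) := if b then ~` B else B.

Let outside (w : Omega) : {set 'I_M} := [set s | `[< ~ B (Xs s n w) >]]%SET.

(** Prescribing exactly which points fall outside B gives events whose probability is a product by
    independence, so that the Chernoff argument becomes a finite sum over J. *)
Let outside_event (J : {set 'I_M}) : set Omega :=
  [set w | forall s, S (s \in J) (Xs s n w)].

Let outside_eventP w : outside_event (outside w) w.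
Proof.
by move=> s; rewrite /S inE; case: asboolP => // /contrapT.
Qed.

Let mS b : measurable (S b).
Proof. by case: b => //; exact: measurableC. Qed.

Let nN1 : (n < N.+1)%N. Proof. by []. Qed.

Let P_outside J :
  P (outside_event J) = (\prod_s (if s \in J then q else 1 - q))%:E.
Proof.
have [law ind] := XsP.
pose E (s : 'I_M) : set (N.+1.-tuple 'rV[R]_d) :=
  (fun t => tnth t (Ordinal nN1)) @^-1` S (s \in J).
have mE s : measurable (E s).
  by rewrite -[X in measurable X]setTI; apply: measurable_tnth.
have := ind E mE.
have -> : [set w | forall s, E s (history N (Xs s) w)] = outside_event J.
  by apply/seteqP; split => w h s; have := h s; rewrite /E/= tnth_mktuple.
move=> ->; rewrite -prodEFin; apply: eq_bigr => s _.
rewrite law//.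
have -> : history N X @^-1` E s = X n @^-1` S (s \in J).
  by apply/seteqP; split => w; rewrite /E/= tnth_mktuple.
by rewrite /S; case: ifP => _; [rewrite qE|rewrite pB].
Qed.

Let m_outside J : measurable (outside_event J).
Proof.
have -> : outside_event J = \bigcap_(s in [set: 'I_M]) (Xs s n @^-1` S (s \in J)).
  by apply/seteqP; split => [w h s _|w h s]; exact: h.
by apply: fin_bigcap_measurable => [|s _]; [exact: finite_finset|exact: mRV].
Qed.

Definition few_inside : set Omega :=
  [set w | (#|[set s | `[< B (Xs s n w) >]]%SET| < k)%N].

Let few (J : {set 'I_M}) := (#|~: J| < k)%N.

Let few_insideE : few_inside =
  \big[setU/set0]_(J <- enum {set 'I_M} | few J) outside_event J.
Proof.
apply/seteqP; split => w; rewrite -bigcup_seq_cond.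
  move=> wk; exists (outside w); last exact: outside_eventP.
  rewrite /= mem_enum /few andTb (leq_ltn_trans _ wk)//.
  apply/subset_leq_card/fintype.subsetP => s; rewrite !inE => h.
  by move/asboolPn: h => /contrapT.
move=> [J /= /andP[_ Jk] wJ]; rewrite /few_inside /= (leq_ltn_trans _ Jk)//.
apply/subset_leq_card/fintype.subsetP => s; rewrite !inE => Bs.
by have := wJ s; rewrite /S; case: (s \in J).
Qed.

Lemma measurable_few_inside : measurable few_inside.
Proof. by rewrite few_insideE; apply: bigsetU_measurable => J _. Qed.

(** Chernoff bound with parameter a: the exponent is -M a^2 + M a^2 / 4, which is at most -M a^2 /
    2. *)
Lemma few_inside_le (a : R) : 0 <= a -> a <= (M%:R - k%:R) / M%:R - q ->
  (P few_inside <= (expR (- (M%:R * a ^+ 2 / 2)))%:E)%E.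
Proof.
move=> a0 aq; have /andP[q0 q1] := q01.
have M0 : 0 < M%:R :> R by rewrite ltr0n; case/andP: k0 => /leq_trans; apply.
have Mk1 : (M%:R - k%:R) / M%:R <= 1 :> R.
  by rewrite ler_pdivrMr// mul1r gerBl ler0n.
have a1 : a <= 1 by lra.
pose pJ (J : {set 'I_M}) := \prod_s (if s \in J then q else 1 - q).
have pJ0 J : 0 <= pJ J.
  by apply: prodr_ge0 => s _; case: ifP; rewrite ?subr_ge0.
have h1 : (P few_inside <= (\sum_(J : {set 'I_M} | few J) pJ J)%:E)%E.
  rewrite few_insideE -big_filter.
  apply: le_trans (measure_bigU_le P _ m_outside) _.
  rewrite big_filter -sumEFin le_eqVlt; apply/orP; left; apply/eqP.
  rewrite (eq_bigr (fun J => (pJ J)%:E)); last by move=> J _; exact: P_outside.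
  by rewrite big_enum_cond.
apply: le_trans h1 _; rewrite lee_fin.
(* Exponentially tilted weights: [wt J] is [pJ J] times exp(a (|J| - M q)), and their sum over all J
   factors into an M-th power. *)
pose wt (J : {set 'I_M}) := \prod_s
  (if s \in J then q * expR (a * (1 - q)) else (1 - q) * expR (- (a * q))).
have wtE J : wt J = pJ J * expR (a * (#|J|%:R - M%:R * q)).
  pose e (s : 'I_M) := a * ((s \in J)%:R - q).
  have -> : a * (#|J|%:R - M%:R * q) = \sum_(s < M) e s.
    rewrite -mulr_sumr sumrB sumr_const card_ord -[q *+ M]mulr_natl.
    congr (_ * (_ - _)); rewrite -sum1_card natr_sum big_mkcond.
    by apply: eq_bigr => s _; case: (s \in J).
  rewrite expR_sum -big_split/=; apply: eq_bigr => s _; rewrite /e.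
  by case: ifP => _ //; rewrite sub0r mulrN.
(* Fewer than k points inside means |J| >= M - k >= M (q + a), so the tilting factor is at least
   exp(M a^2). *)
have h2 J : few J -> pJ J <= expR (- (a * (M%:R * a))) * wt J.
  move=> fJ; rewrite wtE mulrCA ler_peMr// -expRD.
  apply: le_trans (expR_ge1Dx _); rewrite lerDl.
  rewrite -[X in 0 <= X + _]mulrN -mulrDr mulr_ge0//.
  have g1 : (M%:R - k%:R) - M%:R * q - M%:R * a >= 0.
    have -> : M%:R - k%:R - M%:R * q - M%:R * a =
      M%:R * ((M%:R - k%:R) / M%:R - q - a) by field; rewrite gt_eqF.
    by rewrite mulr_ge0 ?(ltW M0)// subr_ge0.
  have g2 : (M <= #|J| + k)%N.
    by rewrite -[X in (X <= _)%N](card_ord M) -(cardsC J) leq_add2l ltnW.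
  rewrite -(ler_nat R) natrD in g2.
  rewrite -subr_ge0 in g2; move: (addr_ge0 g1 g2); congr (0 <= _); ring.
apply: (@le_trans _ _ (expR (- (a * (M%:R * a))) * \sum_(J : {set 'I_M}) wt J)).
  rewrite mulr_sumr [leRHS](bigID few)/= -[leLHS]addr0 lerD//.
    by apply: ler_sum => J; exact: h2.
  apply: sumr_ge0 => J _; rewrite mulr_ge0 ?expR_ge0// wtE mulr_ge0 ?expR_ge0//.
rewrite -bigA_distr/= prodr_const card_ord.
have := bernoulli_mgf q01 (introT andP (conj a0 a1)).
set z := _ + _ => hz.
have z0 : 0 <= z by rewrite addr_ge0 ?mulr_ge0 ?expR_ge0 ?subr_ge0.
apply: (@le_trans _ _ (expR (- (a * (M%:R * a))) * expR (a ^+ 2 / 4) ^+ M)).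
  by rewrite ler_wpM2l ?expR_ge0// lerXn2r ?nnegrE ?expR_ge0.
rewrite -expRM_natl -expRD ler_expR.
have : 0 <= M%:R * a ^+ 2 by rewrite mulr_ge0 ?sqr_ge0// ltW.
rewrite expr2; lra.
Qed.

Lemma few_inside_tail (u : R) : q <= u ->
  (P few_inside <=
   (expR (- (M%:R * Num.max ((M%:R - k%:R) / M%:R - u) 0 ^+ 2 / 2)))%:E)%E.
Proof.
move=> qu; have [h|h] := leP ((M%:R - k%:R) / M%:R - u) 0.
  rewrite expr0n mulr0 mul0r oppr0 expR0.
  by apply: probability_le1; exact: measurable_few_inside.
by apply: few_inside_le; [exact: ltW|lra].
Qed.

End hoeffding.

(** * Stability of maxima, truncation and clipping *)

Section deterministic_bounds.
Context {R : realType}.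

Lemma dist_bigmax (I : Type) (s : seq I) (u0 v0 e : R) (u v : I -> R) :
  `|u0 - v0| <= e -> (forall i, `|u i - v i| <= e) ->
  `|\big[Num.max/u0]_(i <- s) u i - \big[Num.max/v0]_(i <- s) v i| <= e.
Proof.
move=> e0 e1; elim: s => [|i s IHs]; first by rewrite !big_nil.
rewrite !big_cons; move: (e1 i) IHs.
move: (\big[Num.max/u0]_(j <- s) u j) (\big[Num.max/v0]_(j <- s) v j) => p q.
rewrite !ler_norml => /andP[h1 h2] /andP[h3 h4].
by case: (leP (u i) p) => ?; case: (leP (v i) q) => ?; apply/andP; split; lra.
Qed.

Lemma dist_truncation (g t c : R) : `|g| <= c ->
  `|Num.sg t * Num.min `|t| c - g| <= `|t - g|.
Proof.
move=> gc; have c0 : 0 <= c := le_trans (normr_ge0 _) gc.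
have [tc|tc] := leP `|t| c; first by rewrite -numEsg.
move: gc; rewrite ler_norml => /andP[g1 g2].
have [t0|t0] := leP 0 t.
  rewrite ger0_norm// in tc; have t1 : 0 < t by exact: le_lt_trans tc.
  by rewrite gtr0_sg// mul1r !ger0_norm; lra.
rewrite ltr0_norm// in tc.
by rewrite ltr0_sg// mulN1r !ler0_norm; lra.
Qed.

Lemma norm_truncation_le (t c : R) : 0 <= c -> `|Num.sg t * Num.min `|t| c| <= c.
Proof.
move=> c0; rewrite normrM; apply: (@le_trans _ _ (1 * `|Num.min `|t| c|)).
  by rewrite ler_wpM2r// normr_sg lern1; case: (t != 0).
by rewrite mul1r ger0_norm ?le_min ?normr_ge0// ge_min lexx orbT.
Qed.

Definition clip (c v : R) : R := Num.max (- c) (Num.min c v).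

Lemma norm_clip_le c v : 0 <= c -> `|clip c v| <= c.
Proof.
move=> c0; rewrite ler_norml /clip le_max lexx/= ge_max; apply/andP; split.
  by lra.
by rewrite ge_min lexx.
Qed.

Lemma clip_id c v : `|v| <= c -> clip c v = v.
Proof.
by rewrite ler_norml => /andP[h1 h2]; rewrite /clip min_r// max_r.
Qed.

End deterministic_bounds.

Section union_bound_const.
Context {d0 : measure_display} {Omega : measurableType d0} {R : realType}.
Variable P : {measure set Omega -> \bar R}.

Lemma measure_bigU_le_const (I : eqType) (s : seq I) (A : I -> set Omega) (c : R) :
  (forall i, measurable (A i)) -> (forall i, i \in s -> (P (A i) <= c%:E)%E) ->
  (P (\big[setU/set0]_(i <- s) A i) <= ((size s)%:R * c)%:E)%E.
Proof.
move=> mA Ac; apply: le_trans (measure_bigU_le P s mA) _.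
elim: s Ac => [_|i s IHs Ac]; first by rewrite big_nil mul0r.
rewrite big_cons /= -natr1 mulrDl mul1r [X in (_ <= X%:E)%E]addrC EFinD; apply: leeD.
  by apply: Ac; rewrite mem_head.
by apply: IHs => j js; apply: Ac; rewrite in_cons js orbT.
Qed.

End union_bound_const.

(** * Sampling error and displacement error of the estimator *)

Section estimation_error.
Context {R : realType} {d D M mY : nat}.
Variables (k n : nat) (xs : 'I_M -> nat -> 'rV[R]_d)
  (xt : nat -> 'I_M -> 'I_mY -> 'rV[R]_d) (W : 'I_D -> 'rV[R]_d -> R).
Hypotheses (k0 : (0 < k <= M)%N) (mY0 : (0 < mY)%N).

Definition batch (S : {set 'I_M}) : seq ('I_M * 'I_mY) :=
  enum (finset.setX S [set: 'I_mY]%SET).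

Lemma batch_uniq S : uniq (batch S). Proof. exact: enum_uniq. Qed.

Lemma size_batch S : size (batch S) = (#|S| * mY)%N.
Proof. by rewrite -cardE cardsX cardsT card_ord. Qed.

Lemma sum_batch S (F : 'I_M * 'I_mY -> R) :
  \sum_(i <- batch S) F i = \sum_(s in S) \sum_(h < mY) F (s, h).
Proof.
rewrite big_enum /= pair_big_dep /=; apply: eq_big => [[s h]|[s h] _ //].
by rewrite finset.in_setX finset.in_setT andbT.
Qed.

Lemma g_tilde_error (g : 'rV[R]_d -> R) j x (e1 e2 : R) :
  `|\sum_(i <- batch (knn k xs n x)) (W j (xt n i.1 i.2) - g (xs i.1 n))| <=
    (k * mY)%:R * e1 ->
  (forall s, s \in knn k xs n x -> `|g (xs s n) - g x| <= e2) ->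
  `|g_tilde_of k xs xt n W j x - g x| <= e1 + e2.
Proof.
case/andP: k0 => k1 kM; set S := knn k xs n x => h1 h2.
have cS : #|S| = k by exact: card_knn.
have kR : 0 < k%:R :> R by rewrite ltr0n.
have mR : 0 < mY%:R :> R by rewrite ltr0n.
have kmR : 0 < k%:R * mY%:R :> R by rewrite mulr_gt0.
set B := \sum_(i <- batch S) _ in h1.
(* The value of g at each neighbour is subtracted and added back: the first average is the sampling
   error, the second the displacement. The weights match because [knn] has exactly k elements. *)
have -> : g_tilde_of k xs xt n W j x - g x =
    (k%:R * mY%:R)^-1 * B + k%:R^-1 * \sum_(s in S) (g (xs s n) - g x).
  rewrite /B sum_batch /=.
  under [X in _ = (_ * X) + _]eq_bigr => s _.
    rewrite sumrB sumr_const card_ord -[X in _ - X]mulr_natl; over.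
  rewrite !sumrB -mulr_sumr sumr_const cS -[X in _ + _ * (_ - X)]mulr_natl.
  rewrite /g_tilde_of -/S; field.
  by rewrite !gt_eqF.
apply: le_trans (ler_normD _ _) _; apply: lerD.
  rewrite normrM gtr0_norm ?invr_gt0// mulrC ler_pdivrMr//.
  by rewrite mulrC -natrM.
rewrite normrM gtr0_norm ?invr_gt0// mulrC ler_pdivrMr//.
apply: le_trans (ler_norm_sum _ _ _) _; apply: (@le_trans _ _ (\sum_(s in S) e2)).
  by apply: ler_sum => s sS; exact: h2.
by rewrite sumr_const cS mulr_natr.
Qed.

Lemma best_switch_dist (T : R) (N : nat) (f : 'I_D -> R -> 'rV[R]_d -> R)
    (c : 'I_D -> 'I_D -> R -> 'rV[R]_d -> R) (G G' : 'I_D -> 'rV[R]_d -> R)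
    i x (e : R) : (forall j, `|G j x - G' j x| <= e) ->
  `|best_switch T N f c n G i x - best_switch T N f c n G' i x| <= e.
Proof.
move=> GG; rewrite /best_switch; apply: dist_bigmax => [|j];
  by rewrite opprD addrACA subrr add0r.
Qed.

End estimation_error.

(** * Constants, and the uniform error on Q *)

Section uniform_error.
Context {R : realType} {d : nat}.
Variables (L l1 l2 b : R) (Q : set 'rV[R]_d).
Hypotheses (d_gt0 : (0 < d)%N) (L0 : 0 < L) (l10 : 0 < l1) (l20 : 0 < l2).
Hypotheses (b0 : 0 < b) (Qb : forall x, Q x -> enorm x <= b).
Hypotheses (mQ : measurable Q) (Q0 : (0 < lebesgue_rV d Q)%E).

(* Near Q all data points have norm at most r; the estimates below are uniform
   on that ball. *)
Let r : R := b + 1.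

(** Twice this constant dominates the regression function on Q, so its values lie in the truncation
    interval; the added 1 makes it positive. *)
Definition truncation_const : R := @mean_bound R d L l1 r + 1.

(* The first summand exceeds every truncated error on Q, so that the event is
   null for larger delta and the second case of B_term is never used; the
   second one makes a displacement 2 * (delta / (4 * scale_const)) change the
   regression function by at most delta / 4. *)
Definition scale_const : R :=
  truncation_const * (2 * r + 1) + 2 * @mean_lipschitz R d L l2 r + 1.

(* Adding scale_const keeps the Chernoff parameter delta / (4 v) below 1. *)
Definition variance_const : R := @mgf_bound R d L l1 r + scale_const.

(** The number of balls of radius delta / (4 [scale_const]) needed to cover Q, without its factor
    delta^(-d). Dividing by the volume, which is finite and positive, cancels the factor |Q| of
    [B_term]. *)
Definition cover_const : R :=
  ((2 * b * d%:R + 4^-1) * (4 * scale_const)) ^+ d / volume Q.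

Let r0 : 0 < r. Proof. exact: addr_gt0. Qed.

Lemma truncation_const_gt0 : 0 < truncation_const.
Proof. by rewrite ltr_wpDl// mean_bound_ge0. Qed.

Let mean_lip0 := @mean_lipschitz_ge0 R d L l2 r l20.

Lemma scale_const_gt0 : 0 < scale_const.
Proof.
have := truncation_const_gt0 => h; rewrite ltr_wpDl// addr_ge0//.
  by rewrite mulr_ge0 ?(ltW h)// addr_ge0// mulr_ge0// ltW.
by rewrite mulr_ge0.
Qed.

Lemma variance_const_gt0 : 0 < variance_const.
Proof. exact: ltr_wpDl (mgf_bound_ge0 _ _ l10) scale_const_gt0. Qed.

Let volQ : lebesgue_rV d Q = (volume Q)%:E.
Proof.
by rewrite /volume fineK// ge0_fin_numE ?measure_ge0// (lebesgue_bounded_lty b0 Qb).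
Qed.

Lemma volume_gt0 : 0 < volume Q. Proof. by rewrite -lte_fin -volQ. Qed.

Lemma cover_const_gt0 : 0 < cover_const.
Proof.
rewrite divr_gt0 ?volume_gt0// exprn_gt0// mulr_gt0 ?mulr_gt0 ?scale_const_gt0//.
by rewrite ltr_wpDl// !mulr_ge0// ltW.
Qed.

Let Q_neq0 : Q !=set0.
Proof.
by apply/set0P; apply: contraTneq Q0 => ->; rewrite measure0 ltxx.
Qed.

Context {D M N mY k n : nat} {T : R}.
Variables (f : 'I_D -> R -> 'rV[R]_d -> R)
  (c : 'I_D -> 'I_D -> R -> 'rV[R]_d -> R)
  (rho : 'rV[R]_d -> R -> 'rV[R]_d -> R -> R) (C : nat -> R).
Context {d0 : measure_display} {Omega : measurableType d0}.
Variables (P : probability Omega R).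
Variables (X : nat -> {RV P >-> 'rV[R]_d})
  (Xs : 'I_M -> nat -> {RV P >-> 'rV[R]_d})
  (Xt : nat -> 'I_M -> 'I_mY -> {RV P >-> 'rV[R]_d}).

Local Notation V w := (V_hat T N k f c C (fun s m => Xs s m w)
  (fun m s h => Xt m s h w)).
Local Notation V' w := (V_tilde T N k f c C (fun s m => Xs s m w)
  (fun m s h => Xt m s h w) rho).
Local Notation p := (fun x y => rho x (grid T N n) y (grid T N n.+1)).
Local Notation leb := (lebesgue_rV d).
Local Notation rV := 'rV[R]_d.

Hypotheses (D0 : (0 < D)%N) (N0 : (0 < N)%N) (mY0 : (0 < mY)%N).
Hypotheses (k0 : (0 < k <= M)%N) (T0 : 0 < T) (nN : (n < N)%N).
Hypothesis fcP : measurable_data T f c.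
Hypothesis rhoP : transition_density T N rho.
Hypothesis XsP : independent_copies N X Xs.
Hypothesis XtP : one_step_simulations T N rho Xs Xt.
Hypothesis CnE : C n = truncation_const.
Hypothesis p_le : forall x y, `|p x y| <= l1^-1 * expR (- (l1 * enorm (x - y) ^+ 2)).
Hypothesis p_diff : forall x y, differentiable (p ^~ y) x /\
  enorm (grad (p ^~ y) x) <= l2^-1 * expR (- (l2 * enorm (x - y) ^+ 2)).

Let mp2 : measurable_fun [set: rV * rV] (fun z => p z.1 z.2).
Proof. by have [] := rhoP nN. Qed.

Let mp := measurable_density_section mp2.

Let p0 x y : 0 <= p x y.
Proof. by have [] := rhoP nN. Qed.

Let p1 x : (\int[leb]_y (p x y)%:E = 1)%E.
Proof. by have [] := rhoP nN. Qed.

Let good w := forall (i : 'I_D) x, `|V w n.+1 i x| <= L * (enorm x + 1).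

(** Equals the estimate at [t_(n+1)] on the almost sure event [good], but obeys the growth bound for
    every w, as the exponential moment lemmas require. *)
Let G j w y := clip (growth L y) (V w n.+1 j y).

Let G_le j w y : `|G j w y| <= growth L y.
Proof. by apply: norm_clip_le; exact: growth_ge0. Qed.

Let good_G j w : good w -> G j w = V w n.+1 j.
Proof. by move=> gw; apply/funext => y; rewrite /G clip_id//; exact: gw. Qed.

Let measurable_clip d1 (S : measurableType d1) (h : S * rV -> R) :
  measurable_fun [set: S * rV] h ->
  measurable_fun [set: S * rV] (fun z => clip (growth L z.2) (h z)).
Proof.
move=> mh; have mg : measurable_fun [set: S * rV] (fun z : S * rV => growth L z.2).
  exact: (measurableT_comp (measurable_growth L) measurable_snd).
apply: measurable_maxr; first exact: measurableT_comp.
exact: measurable_minr.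
Qed.

Let n' : 'I_N := Ordinal nN.

Let mG j (i : 'I_M * 'I_mY) :
  measurable_fun [set: g_sigma_algebraType (frozen_events Xs Xt (n', i.1, i.2)) * rV]
    (fun z : g_sigma_algebraType (frozen_events Xs Xt (n', i.1, i.2)) * rV =>
       G j z.1 z.2).
Proof.
set F := g_sigma_algebraType _.
apply: measurable_clip.
apply: (@measurable_V_hat R d D M mY _ F T N k f c C
  (fun s m => Xs s m : F -> rV) (fun m s h => Xt m s h : F -> rV)) => //.
  by move=> s m /andP[_ mN]; apply: measurable_frozen_Xs; exact: ltnW.
move=> s h m /andP[nm mN].
apply: (measurable_frozen_simulation (i := (Ordinal mN, s, h))).
by apply/negP => /eqP[mn _ _]; move: nm; rewrite mn ltnn.
Qed.

Let mGw j w : measurable_fun [set: rV] (G j w).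
Proof.
have : measurable_fun [set: Omega * rV] (fun z : Omega * rV => G j z.1 z.2).
  apply: measurable_clip.
  exact: (@measurable_V_hat R d D M mY _ Omega T N k f c C
    (fun s m => Xs s m : Omega -> rV) (fun m s h => Xt m s h : Omega -> rV)).
move=> mGj; exact: (measurableT_comp mGj (pair1_measurable w)).
Qed.

Let ghat w j x := g_hat_of k C (fun s m => Xs s m w) (fun m s h => Xt m s h w) n
  (V w n.+1) j x.

Let gx w j x := g_exact T N k f c C (fun s m => Xs s m w) (fun m s h => Xt m s h w)
  rho n j x.

Let gxE j w x : good w -> gx w j x = \int[leb]_y (G j w y * p x y).
Proof. by move=> gw; rewrite /gx /g_exact good_G. Qed.

Let gx_le j w x : good w -> enorm x <= r -> `|gx w j x| <= @mean_bound R d L l1 r.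
Proof.
by move=> gw xr; rewrite gxE//; apply: (mean_le l10 mp p0 p_le (mGw j w) (@G_le j w)).
Qed.

Let V_dist w i x (e : R) : good w -> (forall j, `|ghat w j x - gx w j x| <= e) ->
  `|V w n i x - V' w n i x| <= e.
Proof.
move=> gw h; rewrite V_hatE// /V_tilde; apply: best_switch_dist; exact: h.
Qed.

(** The truncated value is at most 2 C0 (b + 1) and the regression function at most C0. The spare 1
    keeps the error strictly below every delta >= [scale_const]. *)
Let crude_error w j x : good w -> Q x -> `|ghat w j x - gx w j x| <= scale_const - 1.
Proof.
move=> gw Qx; have xb := Qb Qx; have C0 := truncation_const_gt0.
have xr : enorm x <= r by apply: le_trans xb _; rewrite /r lerDl.
apply: le_trans (ler_normB _ _) _.
have h1 : `|ghat w j x| <= 2 * truncation_const * (enorm x + 1).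
  rewrite /ghat /g_hat_of CnE; apply: norm_truncation_le.
  by rewrite !mulr_ge0 ?(ltW C0)// addr_ge0// enorm_ge0.
have h2 : `|gx w j x| <= truncation_const.
  by apply: le_trans (gx_le j gw xr) _; rewrite lerDl.
have h3 : 2 * truncation_const * (enorm x + 1) <= 2 * truncation_const * r.
  by rewrite ler_pM2l ?mulr_gt0// lerD2r.
apply: le_trans (lerD (le_trans h1 h3) h2) _.
have -> : scale_const - 1 = 2 * truncation_const * r + truncation_const +
    2 * @mean_lipschitz R d L l2 r by rewrite /scale_const; ring.
by rewrite lerDl mulr_ge0.
Qed.

Variables (delta : R).
Hypotheses (delta0 : 0 < delta) (deltaC : delta <= scale_const).

Let rad : R := delta / (4 * scale_const).

Let rad0 : 0 < rad.
Proof. by rewrite divr_gt0// mulr_gt0// scale_const_gt0. Qed.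

Let rad_le : rad <= 4^-1.
Proof.
rewrite /rad ler_pdivrMr ?mulr_gt0 ?scale_const_gt0//.
by rewrite mulrA mulVf ?mul1r// pnatr_eq0.
Qed.

Let lip_rad : @mean_lipschitz R d L l2 r * (2 * rad) <= delta / 4.
Proof.
have s0 := scale_const_gt0.
have -> : @mean_lipschitz R d L l2 r * (2 * rad) =
    2 * @mean_lipschitz R d L l2 r / scale_const * (delta / 4).
  by rewrite /rad; field; rewrite gt_eqF.
rewrite ler_piMl ?divr_ge0 ?(ltW delta0)// ler_pdivrMr// mul1r.
rewrite /scale_const -addrA [leRHS]addrC -addrA lerDl addr_ge0//.
have C0 := truncation_const_gt0.
by rewrite mulr_ge0 ?(ltW C0)// addr_ge0// mulr_ge0// ltW.
Qed.

Let dev j : 'I_M * 'I_mY -> Omega -> R := sim_deviation T rho Xs Xt r n' (G j).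

(** The cut-off in [dev] is inactive: neighbours within [2 * rad] <= 1/2 of x have norm at most r =
    b + 1. The two parts add up to 3 delta / 4, which leaves the strict gap that the supremum
    needs. *)
Let fine_error w j x : good w -> Q x ->
  (forall s, s \in knn k (fun s m => Xs s m w) n x ->
     enorm (Xs s n w - x) < 2 * rad) ->
  `|\sum_(i <- batch (knn k (fun s m => Xs s m w) n x)) dev j i w| <=
    (k * mY)%:R * (delta / 2) ->
  `|ghat w j x - gx w j x| <= delta / 2 + delta / 4.
Proof.
move=> gw Qx near_x small_dev; have xb := Qb Qx.
have xr : enorm x <= r by apply: le_trans xb _; rewrite /r lerDl.
have Xr s : s \in knn k (fun s m => Xs s m w) n x -> enorm (Xs s n w) <= r.
  move=> sx; have h := near_x s sx.
  have := ler_enormD (Xs s n w - x) x; rewrite subrK => /le_trans; apply.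
  rewrite addrC lerD//; apply: le_trans (ltW h) _.
  by have := rad_le => hr; lra.
apply: le_trans (dist_truncation _ _) _.
  apply: le_trans (gx_le j gw xr) _; rewrite CnE.
  have C0 := truncation_const_gt0.
  apply: (@le_trans _ _ (2 * truncation_const)).
    by rewrite /truncation_const in C0 *; lra.
  by rewrite ler_peMr ?mulr_ge0 ?(ltW C0)// lerDr enorm_ge0.
apply: (g_tilde_error (W := V w n.+1) k0 mY0 (g := gx w j)).
  apply: le_trans small_dev; rewrite le_eqVlt; apply/orP; left; apply/eqP.
  congr `|_|; rewrite !sum_batch; apply: eq_bigr => s sx.
  apply: eq_bigr => h _.
  by rewrite /dev /sim_deviation /deviation /= Xr// gxE// good_G.
move=> s sx; rewrite !gxE//; apply: le_trans lip_rad.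
apply: le_trans (mean_lip l10 l20 mp p0 p_le p_diff (mGw j w) (@G_le j w)
  (Xr s sx) xr) _.
by rewrite ler_wpM2l//; exact/ltW/near_x.
Qed.

Let measurable_eball (x : rV) (s : R) : measurable (eball x s).
Proof.
have md : measurable_fun [set: rV] (fun y => enorm (y - x)).
  apply: measurableT_comp; first exact: measurable_enorm.
  apply: measurable_fun_rV => i; under eq_fun do rewrite !mxE.
  by apply: measurable_funB => //; exact: measurable_coord.
have -> : eball x s = (fun y => enorm (y - x)) @^-1` `]-oo, s[%classic.
  by apply/seteqP; split => y /=; rewrite in_itv.
by rewrite -[X in measurable X]setTI; exact: md.
Qed.

Local Notation bad i := [set w | (delta%:E <=
  ereal_sup [set `|V w n i x - V' w n i x|%:E | x in Q])%E].

Let bad_dist i w e : e < delta ->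
  (forall x, Q x -> `|V w n i x - V' w n i x| <= e) ->
  ~ (delta%:E <= ereal_sup [set `|V w n i x - V' w n i x|%:E | x in Q])%E.
Proof.
move=> ed h; apply/negP; rewrite -ltNge; apply: (@le_lt_trans _ _ e%:E).
  by apply: ge_ereal_sup => _ [x Qx <-]; rewrite lee_fin h.
by rewrite lte_fin.
Qed.

Let few (x : rV) := few_inside Xs n k (eball x rad).

Let few_le x : Q x ->
  (P (few x) <= (expR (- (M%:R *
     Num.max ((M%:R - k%:R) / M%:R - sup_pc P (X n) Q rad) 0 ^+ 2 / 2)))%:E)%E.
Proof.
move=> Qx; apply: (few_inside_tail XsP (ltnW nN) k0); first exact: measurable_eball.
rewrite -/(pc P (X n) rad x) /sup_pc; apply: ub_le_sup; last by exists x.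
have mfar y : measurable [set w | ~ eball y rad (X n w)].
  have my := measurableC (measurable_eball y rad).
  have : measurable (X n @^-1` (~` eball y rad)).
    by rewrite -[Z in measurable Z]setTI; exact: measurable_funP.
  by [].
(* A real supremum bounds its elements only if the set is bounded above; probabilities are at most
   1. *)
exists 1 => _ [y _ <-]; rewrite /pc -lee_fin fineK ?fin_num_measure//.
exact: probability_le1.
Qed.

(** The k points in the ball around the centre y lie within [2 * rad] of x, hence so do the k
    nearest neighbours of x. *)
Let few_near x y w : enorm (x - y) <= rad -> ~ few y w ->
  forall s, s \in knn k (fun s m => Xs s m w) n x ->
  enorm (Xs s n w - x) < 2 * rad.
Proof.
move=> xy /negP; rewrite -leqNgt => ky s; apply: knn_dist_lt.
apply: leq_trans ky _; apply/subset_leq_card/fintype.subsetP => t.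
rewrite !inE /= => ty; apply: le_lt_trans (ler_enormB _ y _) _.
have -> : 2 * rad = rad + rad by ring.
by rewrite ltr_leD// enorm_distC.
Qed.

Let big_dev j (S : {set 'I_M}) : set Omega :=
  [set w | (#|S| * mY)%:R * (delta / 2) <= `|\sum_(i <- batch S) dev j i w|].

Let measurable_big_dev j S : measurable (big_dev j S).
Proof.
have ms : measurable_fun [set: Omega] (fun w => `|\sum_(i <- batch S) dev j i w|).
  apply: measurableT_comp => //; apply: measurable_sum => i.
  exact: (@measurable_sim_deviation R d d0 Omega P T N M mY rho Xs Xt rhoP
    L l1 r L0 l10 n' p_le (G j) (@mG j) (@G_le j) i).
exact: measurable_superlevel.
Qed.

Let big_dev_le j (S : {set 'I_M}) : #|S| = k -> (P (big_dev j S) <=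
  (2 * expR (- (k%:R * mY%:R * delta ^+ 2 / (18 * variance_const))))%:E)%E.
Proof.
move=> Sk; have v0 := variance_const_gt0.
have := @deviation_tail R d d0 Omega P T N M mY rho Xs Xt rhoP XtP L l1 r
  L0 l10 n' p_le (G j) (@mG j) (@G_le j) (batch S) variance_const (delta / 2)
  (batch_uniq S).
rewrite size_batch Sk => h; rewrite /big_dev Sk; apply: le_trans (h _ _ _ _) _ => //.
- by rewrite lerDl ltW// scale_const_gt0.
- by rewrite divr_gt0.
- apply: (@le_trans _ _ scale_const).
    by have := deltaC; have := scale_const_gt0; lra.
  have := mgf_bound_ge0 L r l10 (d := d); rewrite /variance_const.
  by have := scale_const_gt0; lra.
rewrite lee_fin ler_pM2l// ler_expR lerN2 natrM.
(* The Chernoff bound at delta / 2 gives the constant 16, better than 18: 1/16 = 1/18 + 1/144. *)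
have -> : k%:R * mY%:R * (delta / 2) ^+ 2 / (4 * variance_const) =
  k%:R * mY%:R * delta ^+ 2 / (18 * variance_const) +
  k%:R * mY%:R * delta ^+ 2 / (144 * variance_const).
  by field; rewrite gt_eqF.
by rewrite lerDl divr_ge0 ?mulr_ge0 ?sqr_ge0// ltW.
Qed.

Hypothesis agood : {ae P, forall w, good w}.

Lemma mu_ext_bad_small i : (mu_ext P (bad i) <=
  (2 * D%:R * 'C(M, k)%:R *
     expR (- (k%:R * mY%:R * delta ^+ 2 / (18 * variance_const))) +
   D%:R * (cover_const * (volume Q / delta ^+ d) *
     expR (- (M%:R * Num.max ((M%:R - k%:R) / M%:R - sup_pc P (X n) Q rad) 0
       ^+ 2 / 2))))%:E)%E.
Proof.
have [I [ctr [Icard Qctr cov]]] := euclidean_cover d_gt0 b0 Qb Q_neq0 rad0 rad_le.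
have [B [mB PB sub]] := agood.
pose A1 := \big[setU/set0]_(a <- enum I) few (ctr a).
pose pairs := enum (finset.setX [set: 'I_D]%SET
  [set S : {set 'I_M} | #|S| == k]%SET).
pose A2 := \big[setU/set0]_(a <- pairs) big_dev a.1 a.2.
have mfew a : measurable (few (ctr a)).
  exact: (measurable_few_inside _ _ _ (measurable_eball (ctr a) rad)).
have mA1 : measurable A1 by exact: bigsetU_measurable.
have mA2 : measurable A2 by apply: bigsetU_measurable => a _; exact: measurable_big_dev.
set tail := expR (- (M%:R * _ / 2)).
have PA1 : (P A1 <= (#|I|%:R * tail)%:E)%E.
  by rewrite cardE; apply: measure_bigU_le_const => // a _; exact: few_le.
have PA2 : (P A2 <= (D%:R * 'C(M, k)%:R * (2 * expR (- (k%:R * mY%:R * delta ^+ 2 /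
    (18 * variance_const)))))%:E)%E.
  have -> : D%:R * 'C(M, k)%:R = (size pairs)%:R :> R.
    by rewrite -cardE cardsX cardsT card_draws !card_ord natrM.
  apply: measure_bigU_le_const => [a|a]; first exact: measurable_big_dev.
  rewrite mem_enum; case: a => j S; rewrite finset.in_setX !inE /= => /eqP.
  exact: big_dev_le.
(* The covering event is measurable: a large deviation for some mode and some k-set, a covering ball
   with too few points, or the null set [B] containing all failures of the growth bound. *)
apply: (@le_trans _ _ (P (A2 `|` (A1 `|` B)))).
  rewrite -(measurable_mu_extE P); last by do 2 apply: measurableU => //.
  apply: le_mu_ext => w wbad; apply: contrapT => /not_orP[w2 /not_orP[w1 wB]].
  have gw : good w by apply: contrapT => ng; apply: wB; exact: sub.
  suff : forall x, Q x -> `|V w n i x - V' w n i x| <= delta / 2 + delta / 4.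
    by move=> /bad_dist; apply=> //; have := delta0; lra.
  move=> x Qx; apply: V_dist => // j; have [a xa] := cov x Qx.
  apply: fine_error => //.
    apply: few_near xa _ => wf; apply: w1; rewrite /A1 -bigcup_seq.
    by exists a => //; rewrite /= mem_enum.
  set S := knn _ _ _ _; have Sk : #|S| = k by apply: card_knn; case/andP: k0.
  rewrite leNgt; apply/negP => /ltW h; apply: w2; rewrite /A2 -bigcup_seq.
  exists (j, S); last by rewrite /big_dev /= Sk.
  by rewrite /= mem_enum finset.in_setX !inE Sk eqxx.
apply: le_trans (measureU2 _ _ _) _ => //; first exact: measurableU.
rewrite EFinD; apply: leeD.
  apply: le_trans PA2 _; rewrite lee_fin le_eqVlt; apply/orP; left; apply/eqP.
  by ring.
apply: (@le_trans _ _ (P A1 + P B)%E); first exact: measureU2.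
rewrite PB adde0.
apply: le_trans PA1 _; rewrite lee_fin mulrA ler_wpM2r ?expR_ge0//.
apply: le_trans Icard _.
have s0 := scale_const_gt0; have v0 := volume_gt0.
have -> : cover_const * (volume Q / delta ^+ d) =
    ((2 * b * d%:R + 4^-1) / rad) ^+ d.
  rewrite /cover_const mulrA divfK ?gt_eqF// -exprVn -exprMn.
  by congr (_ ^+ d); rewrite /rad; field; rewrite !gt_eqF.
(* One cover serves all modes; the factor D of the second term is slack, by D >= 1. *)
rewrite ler_peMl ?ler1n// exprn_ge0// divr_ge0 ?(ltW rad0)//.
by rewrite addr_ge0// !mulr_ge0// ltW.
Qed.

Lemma mu_ext_bad_large i : scale_const <= delta -> (mu_ext P (bad i) <= 0)%E.
Proof.
move=> sd; have [B [mB PB sub]] := agood.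
rewrite -PB -(measurable_mu_extE P mB); apply: le_mu_ext => w wbad.
apply: sub => gw; move: wbad; apply: (@bad_dist i w (scale_const - 1)); first lra.
by move=> x Qx; apply: V_dist => // j; exact: crude_error.
Qed.

End uniform_error.

(** The four constants are chosen before the data, the process and the probability space, which
    expresses what they may depend on. The outer measure and the extended supremum give the event a
    meaning even if the supremum is not measurable or not finite. *)
Theorem theorem5p3 (R : realType) (d : nat) (L lambda1 lambda2 : R)
    (Q : set 'rV[R]_d) :
  (0 < d)%N -> 0 < L -> 0 < lambda1 -> 0 < lambda2 ->
  measurable Q -> bounded_set Q -> (0 < lebesgue_rV d Q)%E ->
  exists C0 C1 C2 sigma : R,
    [/\ 0 < C0, 0 < C1, 0 < C2 & 0 < sigma] /\
  forall (D M N mY k n : nat) (T : R)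
    (f : 'I_D -> R -> 'rV[R]_d -> R) (c : 'I_D -> 'I_D -> R -> 'rV[R]_d -> R)
    (rho : 'rV[R]_d -> R -> 'rV[R]_d -> R -> R) (C : nat -> R)
    (d0 : measure_display) (Omega : measurableType d0)
    (P : probability Omega R) (mu0 : probability 'rV[R]_d R)
    (X : nat -> {RV P >-> 'rV[R]_d})
    (Xs : 'I_M -> nat -> {RV P >-> 'rV[R]_d})
    (Xt : nat -> 'I_M -> 'I_mY -> {RV P >-> 'rV[R]_d}),
  let V_hat_at (w : Omega) :=
    V_hat T N k f c C (fun s m => Xs s m w) (fun m s h => Xt m s h w) in
  let V_tilde_at (w : Omega) :=
    V_tilde T N k f c C (fun s m => Xs s m w) (fun m s h => Xt m s h w) rho in
  (0 < D)%N -> (0 < N)%N -> (0 < mY)%N -> (0 < k <= M)%N -> 0 < T ->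
  (n < N)%N ->
  switching_costs T c -> measurable_data T f c ->
  sub_gaussian mu0 -> transition_density T N rho ->
  markov_process T N rho mu0 X ->
  independent_copies N X Xs ->
  one_step_simulations T N rho Xs Xt ->
  C n = C0 ->
  (forall (x y : 'rV[R]_d) (m : nat), (m < N)%N ->
     `|rho x (grid T N m) y (grid T N m.+1)| <=
     lambda1^-1 * expR (- (lambda1 * enorm (x - y) ^+ 2))) ->
  (forall (x y : 'rV[R]_d) (m : nat), (m < N)%N ->
     differentiable (fun z => rho z (grid T N m) y (grid T N m.+1)) x /\
     enorm (grad (fun z => rho z (grid T N m) y (grid T N m.+1)) x) <=
     lambda2^-1 * expR (- (lambda2 * enorm (x - y) ^+ 2))) ->
  {ae P, forall w, forall (i : 'I_D) (x : 'rV[R]_d),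
     `|V_hat_at w n.+1 i x| <= L * (enorm x + 1)} ->
  forall (delta : R) (i : 'I_D), 0 < delta ->
  (mu_ext P
     [set w | (delta%:E <=
       ereal_sup [set `|V_hat_at w n i x - V_tilde_at w n i x|%:E | x in Q])%E]
   <= (2 * D%:R * 'C(M, k)%:R *
         expR (- (k%:R * mY%:R * delta ^+ 2 / (18 * sigma ^+ 2))) +
       D%:R * B_term P (X n) Q M k C1 C2 delta)%:E)%E.
Proof.
move=> d_gt0 L0 l10 l20 mQ /bounded_set_enorm[b b0 Qb] Q0.
have C20 := @scale_const_gt0 R d L lambda1 lambda2 b l10 l20 b0.
have v0 := @variance_const_gt0 R d L lambda1 lambda2 b l10 l20 b0.
exists (@truncation_const R d L lambda1 b).
exists (@cover_const R d L lambda1 lambda2 b Q).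
exists (@scale_const R d L lambda1 lambda2 b).
exists (Num.sqrt (@variance_const R d L lambda1 lambda2 b)).
have C10 : 0 < @cover_const R d L lambda1 lambda2 b Q by exact: cover_const_gt0.
split; first by split; rewrite ?sqrtr_gt0//; exact: truncation_const_gt0.
move=> D M N mY k n T f c rho C d0 Omega P mu0 X Xs Xt V_hat_at V_tilde_at.
move=> D0 N0 mY0 kM T0 nN _ fcP _ rhoP _ XsP XtP CnE p_le p_diff good delta i delta0.
rewrite sqr_sqrtr ?(ltW v0)// /B_term ler_pdivrMr// mul1r.
have tail0 r (z : R) : 0 <= z -> 0 <= cover_const L lambda1 lambda2 b Q * (volume Q / z) *
    expR (- (M%:R * Num.max ((M%:R - k%:R) / M%:R - sup_pc P (X n) Q r) 0 ^+ 2 / 2)).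
  move=> z0; apply: mulr_ge0 (expR_ge0 _); apply: mulr_ge0 (ltW C10) _.
  exact: divr_ge0 (ltW (volume_gt0 b0 Qb mQ Q0)) z0.
have [deltaC|deltaC] := leP delta (@scale_const R d L lambda1 lambda2 b).
  apply: (mu_ext_bad_small d_gt0 L0 l10 l20 b0 Qb mQ Q0) => //.
    by move=> x y; exact: p_le.
  by move=> x y; exact: p_diff.
(* For delta above [scale_const] the event is null, and the right-hand side only has to be
   nonnegative. *)
apply: (@le_trans _ _ 0%E).
  apply: (mu_ext_bad_large L0 l10 l20 Qb) => //; last exact: ltW.
  by move=> x y; exact: p_le.
rewrite lee_fin; apply: addr_ge0; first by rewrite !mulr_ge0 ?expR_ge0.
by apply: mulr_ge0 => //; apply: tail0; exact: powR_ge0.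
Qed.
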